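(* Let $F$ be a non-zero (commutative, unital) ring, let $I$ be a non-empty (not necessarily finite) index set, and let $A = F[t_i \mid i \in I]$ be the polynomial algebra over $F$ in the variables $t_i$, $i \in I$. Then the following statements are equivalent: \begin{enumerate} \item[(a)] $F$ is an algebraically closed field and $|I| < |F|$ holds for the cardinalities. \item[(b)] For every proper ideal $\mathfrak{a}$ of $A$ there exists an $F$-algebra homomorphism $A/\mathfrak{a} \to F$. \item[(c)] For every maximal ideal $\mathfrak{m}$ of $A$ there exists an $F$-algebra homomorphism $A/\mathfrak{m} \to F$. \item[(d)] Every maximal ideal $\mathfrak{m}$ of $A$ is of the form $\mathfrak{m} = \mathfrak{m}_x$ for some $x \in F^I$. \item[(e)] The assignment $x \mapsto \mathfrak{m}_x$ defines a bijection $F^I \to \mathrm{Smax}(A)$. \item[(f)] $F$ is a field, and for every $\mathfrak{m} \in \mathrm{Smax}(A)$ and all $i_1, \dots, i_n \in I$ (with $n \geq 1$) there exist $x_{i_1}, \dots, x_{i_n} \in F$ such that \[ \mathfrak{m} \cap F[t_{i_1}, \ldots, t_{i_n}] = \langle t_{i_1} - x_{i_1}, \dots, t_{i_n} - x_{i_n} \rangle, \] where the right-hand side is the ideal generated in $F[t_{i_1}, \ldots, t_{i_n}]$. \item[(g)] $F$ is a field, and for every ideal $\mathfrak{a}$ of $A$ we have $\mathbb{V}(\mathfrak{a}) = \emptyset$ if and only if $\mathfrak{a} = A$. \item[(h)] $F$ is a field, and every field extension $F \subseteq K$ of the form $K = F[u_i \mid i \in I]$ (that is, $K$ is a field which is generated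 as an $F$-algebra by a family $(u_i)_{i \in I}$ of elements of $K$) is trivial, i.e. $K = F$. \item[(i)] For every ideal $\mathfrak{a}$ of $A$ we have $\sqrt{\mathfrak{a}} = \mathbb{I}(\mathbb{V}(\mathfrak{a}))$. \end{enumerate}
   Context: All rings and algebras are commutative, non-zero, with unit, and homomorphisms preserve the unit element. $\mathrm{Smax}(A)$ denotes the set of maximal ideals of $A$. For an ideal $\mathfrak{a}$ of $A$, its zero set is $\mathbb{V}(\mathfrak{a}) = \{x \in F^I \mid f(x) = 0 \text{ for all } f \in \mathfrak{a}\}$. For a subset $X \subseteq F^I$, its vanishing ideal is $\mathbb{I}(X) = \{f \in A \mid f(x) = 0 \text{ for all } x \in X\}$ (so $\mathbb{I}(\emptyset) = A$). For a point $x \in F^I$, $\mathfrak{m}_x = \mathbb{I}(\{x\})$ denotes the vanishing ideal of $x$. $\sqrt{\mathfrak{a}}$ is the radical of $\mathfrak{a}$ in $A$. $|S|$ denotes the cardinality of a set $S$. *)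

(* Defs.v *)
From HB Require Import structures.
From mathcomp Require Import all_boot all_algebra.
From mathcomp Require Import finmap.
From mathcomp Require Import boolp classical_sets functions cardinality.
From mathcomp Require Import monalg.

Set Implicit Arguments.
Unset Strict Implicit.
Unset Printing Implicit Defensive.

Import GRing.Theory.

Local Open Scope classical_set_scope.
Local Open Scope ring_scope.
Local Open Scope quotient_scope.

Definition is_field (R : comNzRingType) : Prop :=
  forall x : R, x != 0 -> exists y : R, x * y = 1.

Definition card_lt (T U : Type) (A : set T) (B : set U) : Prop :=
  (A #<= B)%card /\ ~ (B #<= A)%card.

Section Ideals.
Variable R : comNzRingType.
Implicit Types S J X a m : set R.

(* J is an ideal of the subring S of R; only the elements of S act on J. *)
Definition ideal_of S J : Prop :=
  [/\ J `<=` S, J 0, (forall x y, J x -> J y -> J (x + y))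
    & (forall r x, S r -> J x -> J (r * x))].

Definition is_ideal (a : set R) : Prop := ideal_of [set: R] a.

Definition Smax : set (set R) :=
  [set m | [/\ is_ideal m, m <> [set: R]
    & forall a, is_ideal a -> m `<=` a -> a = m \/ a = [set: R]]].

(* The exponent 0 is harmless: it only contributes when 1 is in a. *)
Definition radical a : set R := [set f | exists n : nat, a (f ^+ n)].

(* The ideal of the subring S generated by X. *)
Definition gen_ideal S X : set R := smallest (ideal_of S) X.

(* With the classical axioms, the boolean predicates of type [idealr R] are exactly
   the proper ideals of R. *)
Lemma idealrP a :
  (is_ideal a /\ a <> [set: R]) <-> (exists b : idealr R, a = [set` b]).
Proof.
split=> [[[_ a0 aD aM] aT]|[b ->]].
  have cl : idealr_closed (fun x : R => `[< a x >]).
    split; first exact/asboolP.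
      apply/asboolP => a1; apply: aT; apply/seteqP; split=> // x _.
      by rewrite -[x]mulr1; exact: aM.
    move=> r x y /asboolP ax /asboolP ay; apply/asboolP.
    by apply: aD => //; exact: aM.
  pose M := isIdealr.Build R _ cl.
  pose b : idealr R := HB.pack (fun x : R => `[< a x >]) M.
  by exists b; apply/seteqP; split=> x; move/asboolP.
split; first split=> //=.
- exact: rpred0.
- by move=> x y; exact: rpredD.
- by move=> r x _; exact: idealMr.
- by move/seteqP => [_ /(_ 1 I)] /=; rewrite idealr1.
Qed.

End Ideals.

(* R[X], the R-subalgebra of A generated by X. *)
Definition gen_subalg (R : comNzRingType) (A : comAlgType R) (X : set A) :
    set A :=
  smallest (fun S : set A => GRing.subalg_closed (mem S)) X.

(* The library equips {ideal_quot a} only with a ring structure; here it gets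
   the algebra structure for which \pi is R-linear. *)
Section QuotientAlgebra.
Variables (R : comNzRingType) (A : comAlgType R) (a : idealr A).

Definition quot_scale (c : R) (x : {ideal_quot a}) : {ideal_quot a} :=
  \pi_({ideal_quot a}) (c%:A) * x.

Fact quot_scaleA c d x : quot_scale c (quot_scale d x) = quot_scale (c * d) x.
Proof. by rewrite /quot_scale mulrA -rmorphM /= -scalerAl mul1r scalerA. Qed.

Fact quot_scale1 : left_id 1 quot_scale.
Proof. by move=> x; rewrite /quot_scale scale1r rmorph1 mul1r. Qed.

Fact quot_scaleDr : right_distributive quot_scale +%R.
Proof. by move=> c x y; rewrite /quot_scale mulrDr. Qed.

Fact quot_scaleDl x : {morph quot_scale^~ x : c d / c + d}.
Proof. by move=> c d; rewrite /quot_scale scalerDl rmorphD mulrDl. Qed.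

HB.instance Definition _ := GRing.Zmodule_isLmodule.Build R {ideal_quot a}
  quot_scaleA quot_scale1 quot_scaleDr quot_scaleDl.

Fact quot_scaleAl (c : R) (x y : {ideal_quot a}) : c *: (x * y) = c *: x * y.
Proof. exact: mulrA. Qed.

HB.instance Definition _ :=
  GRing.Lmodule_isLalgebra.Build R {ideal_quot a} quot_scaleAl.
HB.instance Definition _ :=
  GRing.Lalgebra_isComAlgebra.Build R {ideal_quot a}.

End QuotientAlgebra.

(* The polynomial algebra F[t_i | i in I]: finitely supported functions from
   the commutative monomials over I to F. *)
Notation polyalg F I := {malg F[{cmonom I}]}.

Section Polynomials.
Variables (F : comNzRingType) (I : choiceType).
Implicit Types (a : set (polyalg F I)) (X : set (I -> F)) (x : I -> F).

Definition tvar (i : I) : polyalg F I := mkmalgU (ucm i) 1.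

Definition eval_monom x (m : {cmonom I}) : F :=
  \prod_(i <- finsupp m) x i ^+ m i.

Definition eval (f : polyalg F I) x : F := mmap idfun (eval_monom x) f.

Definition zero_set a : set (I -> F) :=
  [set x | forall f, a f -> eval f x = 0].

Definition vanishing_ideal X : set (polyalg F I) :=
  [set f | forall x, X x -> eval f x = 0].

Definition point_ideal x : set (polyalg F I) := vanishing_ideal [set x].

End Polynomials.

(* Main.v *)
Require Import Defs.
From HB Require Import structures.
From mathcomp Require Import all_boot all_algebra.
From mathcomp Require Import finmap.
From mathcomp Require Import boolp classical_sets functions cardinality.
From mathcomp Require Import monalg.

Import GRing.Theory.

Local Open Scope classical_set_scope.
Local Open Scope ring_scope.

(** The heart of the matter is that, under (a), a residue field K of a polynomial
algebra F[u_j | j in J] is F itself as soon as |J| < |F|. Suppose that t in K is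
not in F; then t is transcendental over F, and each difference t - c with c in F
has an inverse in K, which lies in F[u_s] for some finite sequence s of indices.
Since F is infinite and not of cardinality at most |J|, while there are no more
finite sequences in J than elements of J when J is infinite, a single finite
sequence works for infinitely many c ([infinite_fiber_of_seq]). On the other
hand, in a finitely generated domain over F[t] only finitely many t - c are
invertible: almost every specialization of t to c extends to a homomorphism into
F, which sends t - c to 0 ([specialization_nonunit],
[finite_shifted_inverses]). The same argument thus covers finite J, where it is
Zariski's lemma, and infinite J, where it is usually replaced by a comparison of
dimensions. The cardinal arithmetic needed is that the finite sequences in an
infinite set J inject into J ([infinite_seq_inj]).

Consequently every maximal ideal consists of the polynomials vanishing at some
point ([rational_point]), and a proper ideal has a zero. The trick of Rabinowitsch
gives (i): it needs one more variable, which is harmless because |J| + 1 is still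
not at least |F|.

For the way back, each of (h) and (i) yields that F is a field over which proper
ideals have zeros, and this implies (a). A nonconstant polynomial in one variable
without a root generates a proper ideal without zeros. If F injects into I by phi, put
s = t_phi(0); the relations t_phi(c) (1 - c s) = 1, one for each c other than 0
and 1, together with t_phi(1) s (1 - s) = 1, have no common solution, since they
forbid s to be 0, 1 or any 1 / c. But each finite set of them has a solution, as
F is infinite, so they generate a proper ideal. The other implications are short: a homomorphism
from a quotient into F is the evaluation at a point, and an ideal containing all
t_i - x_i is either everything or the ideal of x. *)

(** * Extending homomorphisms to simple ring extensions *)

Section Extension.
Context {A : comNzRingType}.

Definition poly_eval {K : comNzRingType} (psi : {rmorphism A -> K}) (x : K) :
  {rmorphism {poly A} -> K} := horner_eval x \o map_poly psi.

Lemma poly_evalE (K : comNzRingType) (psi : {rmorphism A -> K}) x p :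
  poly_eval psi x p = (map_poly psi p).[x].
Proof. by []. Qed.

Lemma poly_evalC (K : comNzRingType) (psi : {rmorphism A -> K}) x c :
  poly_eval psi x c%:P = psi c.
Proof. by rewrite poly_evalE map_polyC hornerC. Qed.

Lemma poly_evalX (K : comNzRingType) (psi : {rmorphism A -> K}) x :
  poly_eval psi x 'X = x.
Proof. by rewrite poly_evalE map_polyX hornerX. Qed.

Variables (K : fieldType) (psi : {rmorphism A -> K}) (x : K).
Local Notation "p ^psi" := (map_poly psi p) (at level 2).
Local Notation ev := (poly_eval psi x).

(** The map psi may kill leading coefficients of p; only the image of p matters
for its value at x. *)
Lemma truncate_poly (p : {poly A}) :
  exists2 q : {poly A}, q^psi = p^psi & (size q <= size p^psi)%N.
Proof.
exists (\poly_(i < size p^psi) p`_i); last exact: size_poly.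
apply/polyP => i; rewrite !coef_map coef_poly /=.
by case: ltnP => // hi; rewrite raddf0 -coef_map nth_default.
Qed.

(** As A need not be a domain and psi need not be injective, the relation of least
degree is measured after applying psi; truncation then makes its leading
coefficient survive in K. *)
Lemma minimal_relation (p : {poly A}) : ev p = 0 -> p^psi != 0 ->
  exists P : {poly A}, [/\ ev P = 0, psi (lead_coef P) != 0
    & forall q : {poly A}, ev q = 0 -> q^psi != 0 -> (size P <= size q^psi)%N].
Proof.
move=> p0 pn0.
pose Q n := `[< exists q : {poly A}, [/\ ev q = 0, q^psi != 0 & size q^psi = n] >].
have exQ : exists n, Q n by exists (size p^psi); apply/asboolP; exists p.
case: (ex_minnP exQ) => n /asboolP [q [q0 qn0 <-]] min.
have [P PE sP] := truncate_poly q.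
have sPE : size P = size P^psi.
  by apply/eqP; rewrite eqn_leq size_poly andbT PE.
exists P; split.
- by rewrite poly_evalE PE -poly_evalE.
- by rewrite lead_coefE sPE -coef_map -lead_coefE lead_coef_eq0 PE.
move=> r r0 rn0; rewrite sPE PE; apply: min; apply/asboolP; by exists r.
Qed.

(** P plays the role of the minimal polynomial of x over the fraction field of
psi(A), so it is coprime to v, and clearing denominators in a Bezout identity
gives the nonzero constant c. Euclidean descent avoids the fraction field: among
the polynomials whose value at x is a nonzero multiple of v(x), one of least
degree is constant, for otherwise the remainder of P modulo it, or else the
quotient, contradicts one of the two minimality properties. *)
Lemma bezout_relation (P v : {poly A}) : ev P = 0 -> psi (lead_coef P) != 0 ->
  (forall q : {poly A}, ev q = 0 -> q^psi != 0 -> (size P <= size q^psi)%N) ->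
  ev v != 0 -> exists h c, ev h * ev v = psi c /\ psi c != 0.
Proof.
move=> P0 lP minP v0.
have Pn0 : P^psi != 0.
  by apply: contraNneq lP => PE; rewrite lead_coefE -coef_map PE coef0.
pose Q n := `[< exists r h : {poly A},
  [/\ ev r != 0, ev h * ev v = ev r & size r = n] >].
have exQ : exists n, Q n.
  by exists (size v); apply/asboolP; exists v, 1; rewrite rmorph1 mul1r.
case: (ex_minnP exQ) => n /asboolP [r [h [r0 hr <-]]] {n exQ} min.
have sr : size r^psi = size r.
  have [r' r'E sr'] := truncate_poly r.
  apply/eqP; rewrite eqn_leq size_poly /=; apply: leq_trans sr'.
  by apply: min; apply/asboolP; exists r', h; rewrite !poly_evalE r'E -!poly_evalE.
have [r1|r1] := leqP (size r) 1.
  move: r0 hr; rewrite (size1_polyC r1) poly_evalC => r0 hr.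
  by exists h, r`_0.
have rn0 : r != 0 by rewrite -size_poly_gt0 (ltn_trans _ r1).
have lr : psi (lead_coef r) != 0.
  by rewrite lead_coefE -sr -coef_map -lead_coefE lead_coef_eq0 -size_poly_gt0 sr size_poly_gt0.
have PnN0 : P != 0 by apply: contraNneq Pn0 => ->; rewrite rmorph0.
(* the remainder of r modulo P is again a multiple of v, so r is already reduced *)
have srP : (size r < size P)%N.
  have /(congr1 ev) := Pdiv.ComRing.rdivp_eq P r.
  rewrite -mul_polyC rmorphM poly_evalC rmorphXn rmorphD rmorphM P0 mulr0 add0r => E.
  apply: leq_ltn_trans (Pdiv.CommonRing.ltn_rmodpN0 r PnN0).
  apply: min; apply/asboolP.
  exists (Pdiv.CommonRing.rmodp r P),
    ((lead_coef P ^+ Pdiv.CommonRing.rscalp r P)%:P * h); split => //.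
    by rewrite -E mulf_neq0 // expf_neq0.
  by rewrite -E rmorphM poly_evalC rmorphXn -mulrA hr.
have divE := Pdiv.ComRing.rdivp_eq r P.
set q := Pdiv.CommonRing.rdivp _ _ in divE; set s := Pdiv.CommonRing.rmodp _ _ in divE.
have ss : (size s < size r)%N by exact: Pdiv.CommonRing.ltn_rmodpN0.
have sE : ev s = - (ev q * ev r).
  have /(congr1 ev) := divE.
  rewrite -mul_polyC rmorphM P0 mulr0 rmorphD rmorphM => /esym/eqP.
  by rewrite addrC addr_eq0 => /eqP.
(* s is a multiple of v of smaller degree than r *)
have s0 : ev s = 0.
  apply/eqP; apply: contraLR ss => sn0; rewrite -leqNgt; apply: min; apply/asboolP.
  exists s, (- q * h); split => //.
  by rewrite rmorphM -mulrA hr rmorphN mulNr.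
have q0 : ev q = 0.
  by move/eqP: sE; rewrite s0 eq_sym oppr_eq0 mulf_eq0 (negPf r0) orbF => /eqP.
(* by minimality of P, a relation of smaller degree is trivial *)
have sm0 : s^psi = 0.
  apply/eqP; apply: contraLR ss => sn0; rewrite -leqNgt.
  apply: (@leq_trans (size P)); first exact: ltnW.
  by apply: leq_trans (minP s s0 sn0) _; exact: size_poly.
have mE : (psi (lead_coef r) ^+ Pdiv.CommonRing.rscalp P r) *: P^psi = q^psi * r^psi.
  have /(congr1 (map_poly psi)) := divE.
  by rewrite -mul_polyC rmorphM /= map_polyC /= rmorphXn mul_polyC rmorphD /= rmorphM /= sm0 addr0.
have qn0 : q^psi != 0.
  apply: contraNneq Pn0 => qE; move/eqP: mE.
  by rewrite qE mul0r scaler_eq0 expf_eq0 (negPf lr) andbF.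
(* r has positive degree, so the relation q is of smaller degree than P *)
have := minP q q0 qn0; rewrite leqNgt => /negP[].
apply: (@leq_trans (size P^psi)); last exact: size_poly.
rewrite -(size_scale P^psi (expf_neq0 (Pdiv.CommonRing.rscalp P r) lr)) mE.
rewrite size_mul ?sr //; last by rewrite -size_poly_gt0 sr size_poly_gt0.
by rewrite -[X in (X < _)%N](addn0) -subn1 -addnBA ?ltn_add2l ?subn_gt0 // ltnW.
Qed.

(** Subrings of K are given by homomorphisms psi from an auxiliary ring A, and their
homomorphisms to F by those of A that kill the kernel of psi; passing from A to
the honest ring {poly A} then adjoins x. The condition at v is what
allows the step to be repeated. If x is algebraic over psi(A), away from the leading
coefficient of its minimal relation any root of the image of that relation is a
possible value, and the constant of the Bezout identity makes v nonzero there. If x is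
transcendental, almost any value in the infinite field F will do. *)
Lemma extend_rmorphism (F : fieldType) (v : {poly A}) :
    GRing.closed_field_axiom F -> ev v != 0 ->
  exists2 w : A, psi w != 0 & forall phi : {rmorphism A -> F},
    (forall a, psi a = 0 -> phi a = 0) -> phi w != 0 ->
    exists2 y : F, forall p, ev p = 0 -> poly_eval phi y p = 0
                 & poly_eval phi y v != 0.
Proof.
move=> closedF v0.
have [[p [p0 pn0]]|trans] := pselect (exists p : {poly A}, ev p = 0 /\ p^psi != 0).
  have [P [P0 lP minP]] := minimal_relation _ p0 pn0.
  have [h [c [hE c0]]] := bezout_relation _ _ P0 lP minP v0.
  exists (c * lead_coef P); first by rewrite rmorphM mulf_neq0.
  move=> phi kphi; rewrite rmorphM mulf_eq0 negb_or => /andP[pc pP].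
  have PnN0 : P != 0 by apply: contraNneq lP => ->; rewrite lead_coef0 rmorph0.
  have Pn1 : size P != 1%N.
    apply/negP => /eqP P1; move: P0 lP; rewrite /lead_coef P1.
    by rewrite [P in ev P]size1_polyC ?P1 // poly_evalC => ->; rewrite eqxx.
  have [y yP] : exists y, root (map_poly phi P) y.
    apply/(PreClosedField.closed_rootP closedF).
    by rewrite size_map_poly_id0.
  have compat p' : ev p' = 0 -> poly_eval phi y p' = 0.
    move=> p'0; have divE := Pdiv.ComRing.rdivp_eq P p'.
    set q := Pdiv.CommonRing.rdivp _ _ in divE.
    set s := Pdiv.CommonRing.rmodp _ _ in divE.
    have s0 : ev s = 0.
      have /(congr1 ev) := divE.
      by rewrite -mul_polyC rmorphM p'0 mulr0 rmorphD rmorphM P0 mulr0 add0r.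
    have sm0 : s^psi = 0.
      apply/eqP; apply/negP => /negP /(minP s s0); rewrite leqNgt => /negP[].
      by apply: leq_ltn_trans (size_poly _ _) _; exact: Pdiv.CommonRing.ltn_rmodpN0.
    have sp0 : map_poly phi s = 0.
      apply/polyP => i; rewrite coef_map coef0; apply: kphi.
      by rewrite -coef_map sm0 coef0.
    have /(congr1 (poly_eval phi y)) := divE.
    rewrite -mul_polyC rmorphM rmorphD rmorphM poly_evalC rmorphXn.
    rewrite [X in _ * X + _]poly_evalE (rootP yP) mulr0.
    rewrite [poly_eval phi y s]poly_evalE sp0 horner0 addr0 => /eqP.
    by rewrite mulf_eq0 expf_eq0 (negPf pP) andbF => /eqP.
  exists y => //.
  have /compat : ev (h * v - c%:P) = 0.
    by rewrite rmorphB rmorphM poly_evalC hE subrr.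
  move/eqP; rewrite rmorphB rmorphM poly_evalC subr_eq0 => /eqP E.
  by apply: contraNneq pc => v'0; rewrite -E v'0 mulr0.
have {}trans p : ev p = 0 -> p^psi = 0.
  by move=> p0; apply/eqP/negP => /negP pn0; apply: trans; exists p.
have vn0 : v^psi != 0 by apply: contraNneq v0 => vE; rewrite poly_evalE vE horner0.
exists v`_(size v^psi).-1.
  by rewrite -coef_map -lead_coefE lead_coef_eq0.
move=> phi kphi pv.
have [y yv] : exists y, ~~ root (map_poly phi v) y.
  apply/(PreClosedField.closed_nonrootP closedF).
  by apply: contraNneq pv => vE; rewrite -coef_map vE coef0.
exists y => // p /trans pm.
rewrite poly_evalE; suff -> : map_poly phi p = 0 by rewrite horner0.
apply/polyP => i; rewrite coef_map coef0; apply: kphi.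
by rewrite -coef_map pm coef0.
Qed.

End Extension.

(** * Specializations of finitely generated domains *)

Section Adjunction.
Context {K : comNzRingType}.

Definition subring_set (S : set K) :=
  [/\ S 1, forall x y, S x -> S y -> S (x - y)
    & forall x y, S x -> S y -> S (x * y)].

Definition adjoin (X : set K) : set K := smallest subring_set X.

Lemma sub_adjoin (X : set K) : X `<=` adjoin X.
Proof. exact: sub_gen_smallest. Qed.

Lemma adjoin_min (X S : set K) : subring_set S -> X `<=` S -> adjoin X `<=` S.
Proof. by move=> SS XS; exact: smallest_sub. Qed.

Lemma adjoinS (X Y : set K) : X `<=` Y -> adjoin X `<=` adjoin Y.
Proof. by move=> XY y Xy S [SS YS]; apply: Xy; split => // x /XY /YS. Qed.

Lemma subring_adjoin (X : set K) : subring_set (adjoin X).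
Proof.
split.
- by move=> S [[]].
- by move=> x y Sx Sy S SS; case: (SS) => -[_ SB _] _; apply: SB; [exact: Sx|exact: Sy].
- by move=> x y Sx Sy S SS; case: (SS) => -[_ _ SM] _; apply: SM; [exact: Sx|exact: Sy].
Qed.

Lemma subring_range (A : comNzRingType) (psi : {rmorphism A -> K}) :
  subring_set (range psi).
Proof.
split; first by exists 1 => //; rewrite rmorph1.
  by move=> _ _ [a _ <-] [b _ <-]; exists (a - b) => //; rewrite rmorphB.
by move=> _ _ [a _ <-] [b _ <-]; exists (a * b) => //; rewrite rmorphM.
Qed.

(** The elements that need only finitely many of the u_j form a subring. *)
Lemma adjoin_finite_support (J : Type) (X : set K) (u : J -> K) (y : K) :
  adjoin (X `|` range u) y ->
  exists s : seq J, adjoin (X `|` [set` map u s]) y.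
Proof.
pose S : set K := fun y => exists s : seq J, adjoin (X `|` [set` map u s]) y.
have up2 (x z : K) : S x -> S z -> exists s : seq J,
    adjoin (X `|` [set` map u s]) x /\ adjoin (X `|` [set` map u s]) z.
  move=> [s xs] [r zr]; exists (s ++ r); split.
    by move: xs; apply: adjoinS; apply: setUS => i /=; rewrite map_cat mem_cat => ->.
  by move: zr; apply: adjoinS; apply: setUS => i /=; rewrite map_cat mem_cat orbC => ->.
apply: (@adjoin_min _ S).
  split.
  - by exists [::]; have [] := subring_adjoin (X `|` [set` map u [::]]).
  - move=> x z /up2 /[apply] -[s [xs zs]]; exists s.
    by have [_ SB _] := subring_adjoin (X `|` [set` map u s]); exact: SB.
  - move=> x z /up2 /[apply] -[s [xs zs]]; exists s.
    by have [_ _ SM] := subring_adjoin (X `|` [set` map u s]); exact: SM.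
move=> z [Xz|[j _ <-]]; first by exists [::]; apply: sub_adjoin; left.
by exists [:: j]; apply: sub_adjoin; right; rewrite /= mem_seq1.
Qed.

End Adjunction.

Lemma subring_preimage (A K : comNzRingType) (psi : {rmorphism A -> K}) (S : set K) :
  subring_set S -> subring_set (psi @^-1` S).
Proof.
move=> [S1 SB SM]; split=> [|x y Sx Sy|x y Sx Sy]; rewrite /preimage /=.
- by rewrite rmorph1.
- by rewrite rmorphB; exact: SB.
- by rewrite rmorphM; exact: SM.
Qed.

Section FinitelyManyInverses.
Variables (K F : fieldType).
Hypothesis closedF : GRing.closed_field_axiom F.

(** The given homomorphism extends step by step to the finitely generated ring, where a
relation psi a * b = 1 would be sent to 0 = 1. *)
Lemma specialization_nonunit (A : comNzRingType) (psi : {rmorphism A -> K})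
    (xs : seq K) :
  exists2 w : A, psi w != 0 & forall phi : {rmorphism A -> F},
    (forall a, psi a = 0 -> phi a = 0) -> phi w != 0 ->
    forall a b, phi a = 0 -> adjoin (range psi `|` [set` xs]) b -> psi a * b <> 1.
Proof.
elim: xs A psi => [|x xs IH] A psi.
  exists 1; first by rewrite rmorph1 oner_neq0.
  move=> phi kphi _ a b a0 bA ab.
  have [b' _ b'E] : range psi b.
    by move: bA; apply: adjoin_min; [exact: subring_range|move=> z []].
  have : psi (a * b' - 1) = 0 by rewrite rmorphB rmorphM b'E ab rmorph1 subrr.
  move=> /kphi; rewrite rmorphB rmorphM a0 mul0r rmorph1 sub0r => /eqP.
  by rewrite oppr_eq0 oner_eq0.
have [v v0 vP] := IH _ (poly_eval psi x).
have [w w0 wP] := extend_rmorphism _ psi x _ v closedF v0.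
exists w => // phi kphi phiw a b a0 bA.
have [y ky yv] := wP phi kphi phiw.
rewrite -(poly_evalC _ psi x); apply: (vP (poly_eval phi y) ky yv).
  by rewrite poly_evalC.
move: bA; apply: adjoinS => z [[c _ <-]|].
  by left; exists c%:P => //; rewrite poly_evalC.
rewrite /= in_cons => /orP[/eqP ->|zs]; last by right.
by left; exists 'X => //; exact: poly_evalX.
Qed.

(** Over an algebraically closed field p is a product of linear factors, none of
which vanishes at t. *)
Lemma closed_transcendental (iota : {rmorphism F -> K}) (t : K) (p : {poly F}) :
  (forall c, t <> iota c) -> poly_eval iota t p = 0 -> p = 0.
Proof.
move=> tF; elim: (size p) {-2}p (leqnn (size p)) => {p} [|n IH] p sp p0.
  by apply/eqP; rewrite -size_poly_eq0 -leqn0.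
have [s1|s1] := eqVneq (size p) 1%N.
  move: p0; rewrite (size1_polyC (p := p)) ?s1 // poly_evalC => /eqP.
  by rewrite fmorph_eq0 => /eqP ->.
have [c /factor_theorem [q qE]] : exists x, root p x.
  exact/(PreClosedField.closed_rootP closedF).
suff q0 : q = 0 by rewrite qE q0 mul0r.
have [//|qn0] := eqVneq q 0.
apply: IH.
  by move: sp; rewrite qE size_Mmonic ?monicXsubC // size_XsubC addn2.
move/eqP: p0; rewrite qE rmorphM mulf_eq0 rmorphB poly_evalX poly_evalC => /orP[/eqP //|].
by rewrite subr_eq0 => /eqP /tF.
Qed.

Lemma finite_roots (p : {poly F}) : p != 0 -> finite_set [set c | root p c].
Proof.
move=> p0; apply: contrapT => /infinite_set_fset => /(_ (size p)) [s sp].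
apply/negP; rewrite -ltnNge; apply: max_poly_roots => //; last exact: fset_uniq.
by apply/allP => x; exact: sp.
Qed.

Lemma finite_shifted_inverses (iota : {rmorphism F -> K}) (t : K) (xs : seq K) :
  (forall c, t <> iota c) ->
  finite_set [set c | exists2 b, adjoin (range iota `|` [set` xs]) b
                               & (t - iota c) * b = 1].
Proof.
move=> tF.
have [w w0 wP] := specialization_nonunit _ (poly_eval iota t) xs.
have /finite_roots : w != 0 by apply: contraNneq w0 => ->; rewrite rmorph0.
apply: sub_finite_set => c [b bA tb]; apply/negPn/negP => /= cw.
have tE : t - iota c = poly_eval iota t ('X - c%:P).
  by rewrite rmorphB poly_evalX poly_evalC.
move: tb; rewrite tE; apply: (wP (horner_eval c)) => //.
- by move=> p /(closed_transcendental _ _ _ tF) ->; rewrite rmorph0.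
- by rewrite /= /horner_eval hornerXsubC subrr.
move: bA; apply: adjoinS; apply: setSU => _ [d _ <-].
by exists d%:P => //; rewrite poly_evalC.
Qed.

End FinitelyManyInverses.

(** * Finite sequences in an infinite set *)

Section CardinalComparability.
Variables (T U : Type) (A : set T) (B : set U).

Let partial_injection (G : set (T * U)) :=
  [/\ forall p, G p -> A p.1 /\ B p.2,
      forall x y y', G (x, y) -> G (x, y') -> y = y'
    & forall x x' y, G (x, y) -> G (x', y) -> x = x'].

(** A maximal partial injection is defined on all of A or has all of B as its
range. *)
Lemma injection_total (t0 : T) (u0 : U) :
  (exists2 f : T -> U, set_fun A B f & set_inj A f) \/
  (exists2 g : U -> T, set_fun B A g & set_inj B g).
Proof.
have chain (C : set (set (T * U))) : C `<=` partial_injection ->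
    total_on C subset -> partial_injection (\bigcup_(G in C) G).
  move=> CP Ctot.
  have join p q : (\bigcup_(G in C) G) p -> (\bigcup_(G in C) G) q ->
      exists2 G, partial_injection G & G p /\ G q.
    move=> [G CG Gp] [H CH Hq]; have [GH|HG] := Ctot _ _ CG CH.
      by exists H; [exact: CP|split=> //; exact: GH].
    by exists G; [exact: CP|split=> //; exact: HG].
  split.
  - by move=> p [G /CP[GP _ _] /GP].
  - by move=> x y y' /join/[apply] -[G [_ Gf _] []]; exact: Gf.
  - by move=> x x' y /join/[apply] -[G [_ _ Gi] []]; exact: Gi.
have [G [[GP Gf Gi] Gmax]] := Zorn_bigcup chain.
have [domG|/existsNP[a /not_implyP[Aa nGa]]] :=
    pselect (forall x, A x -> exists y, G (x, y)).
  left; have /choice[f fG] : forall x, exists y, A x -> G (x, y).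
    by move=> x; have [/domG[y]|nA] := pselect (A x); [exists y|exists u0].
  exists f; first by move=> x /fG /GP[].
  move=> x y /set_mem/fG xG /set_mem/fG yG fxy.
  by apply: (Gi _ _ (f x)) => //; rewrite fxy.
have [ranG|/existsNP[b /not_implyP[Bb nGb]]] :=
    pselect (forall y, B y -> exists x, G (x, y)).
  right; have /choice[g gG] : forall y, exists x, B y -> G (x, y).
    by move=> y; have [/ranG[x]|nB] := pselect (B y); [exists x|exists t0].
  exists g; first by move=> y /gG /GP[].
  move=> x y /set_mem/gG xG /set_mem/gG yG gxy.
  by apply: (Gf (g x)) => //; rewrite gxy.
exfalso; apply: (Gmax (G `|` [set (a, b)])).
  split; first by move=> p; left.
  by move=> /(_ (a, b) (or_intror erefl)) Gab; apply: nGa; exists b.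
split.
- by move=> p [/GP//|->].
- move=> x y y' [Gxy|[-> ->]] [Gxy'|].
  + exact: Gf Gxy Gxy'.
  + by case=> xa _; case: nGa; exists y; rewrite -xa.
  + by case: nGa; exists y'.
  + by case.
- move=> x x' y [Gxy|[-> ->]] [Gxy'|].
  + exact: Gi Gxy Gxy'.
  + by case=> _ yb; case: nGb; exists x; rewrite -yb.
  + by case: nGb; exists x'.
  + by case.
Qed.

End CardinalComparability.

Section FiniteSequences.
Variable J : choiceType.
Implicit Types (X : set J) (s t : seq J).

Definition seq_in X s := forall x, x \in s -> X x.

Lemma seq_in_cons X x s : seq_in X (x :: s) -> X x /\ seq_in X s.
Proof.
move=> h; split; first by apply: h; rewrite in_cons eqxx.
by move=> y ys; apply: h; rewrite in_cons ys orbT.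
Qed.

(** All blocks have length two, so that they can be read off from the
concatenation. *)
Lemma flatten_pairs_inj X (enc : J -> seq J) s t :
    (forall x, size (enc x) = 2%N) -> set_inj X enc ->
    seq_in X s -> seq_in X t ->
  flatten (map enc s) = flatten (map enc t) -> s = t.
Proof.
move=> enc2 encI; elim: s t => [|x s IH] [|y t] //=.
- by move=> _ _ /(congr1 size); rewrite size_cat enc2.
- by move=> _ _ /(congr1 size); rewrite size_cat enc2.
move=> /seq_in_cons[Xx Xs] /seq_in_cons[Xy Xt] /eqP.
rewrite eqseq_cat ?enc2 // => /andP[/eqP xy /eqP st].
by rewrite (encI x y (mem_set Xx) (mem_set Xy) xy) (IH t).
Qed.

Section Coding.
Variables x0 x1 : J.
Hypothesis x01 : x0 <> x1.

(** Elements of X are tagged by x0, the others are replaced by elements of X and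
tagged by x1. *)
Let tag_code (X : set J) (g : J -> J) (x : J) : seq J :=
  if `[< X x >] then [:: x0; x] else [:: x1; g x].

Let tag_code2 X g x : size (tag_code X g x) = 2%N.
Proof. by rewrite /tag_code; case: ifP. Qed.

Let tag_code_inj X Y g : set_inj (Y `\` X) g -> set_inj Y (tag_code X g).
Proof.
move=> gI x y /set_mem Yx /set_mem Yy; rewrite /tag_code.
case: asboolP => Xx; case: asboolP => Xy.
- by case.
- by case=> /x01.
- by case=> /esym /x01.
- by case=> /gI; apply; apply: mem_set.
Qed.

Let tag_code_in X Y g s : X x0 -> X x1 -> set_fun (Y `\` X) X g ->
  seq_in Y s -> seq_in X (flatten (map (tag_code X g) s)).
Proof.
move=> X0 X1 gX Ys x /flatten_mapP[y /Ys Yy].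
rewrite /tag_code; case: asboolP => Xy; rewrite !inE => /orP[] /eqP -> //.
exact: gX.
Qed.

(** A partial coding stores all sequences with entries in the set [coded] as
elements of that set. The two distinct elements x0 and x1 serve as tags, which is
why every coded set has to contain them. *)
Record seq_coding := SeqCoding {
  coded : set J;
  code : seq J -> J;
  coded0 : coded x0;
  coded1 : coded x1;
  code_in : forall s, seq_in coded s -> coded (code s);
  code_inj : forall s t, seq_in coded s -> seq_in coded t ->
    code s = code t -> s = t }.

Let extends (c d : seq_coding) := `[< coded c `<=` coded d /\
  forall s, seq_in (coded c) s -> code d s = code c s >].

Let extends_chain (c0 : seq_coding) (C : set seq_coding) :
  total_on C extends -> exists d, forall c, C c -> extends c d.
Proof.
move=> Ctot.
have [[c1 Cc1]|C0] := pselect (exists c, C c); last first.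
  by exists c0 => c Cc; case: C0; exists c.
pose X := \bigcup_(c in C) coded c.
have join c d : C c -> C d -> exists e, [/\ C e, extends c e & extends d e].
  move=> Cc Cd; have self e : extends e e by apply/asboolP; split.
  by have [cd|dc] := Ctot _ _ Cc Cd; [exists d|exists c].
have finX s : seq_in X s -> exists2 c, C c & seq_in (coded c) s.
  elim: s => [|x s IH]; first by exists c1.
  move=> /seq_in_cons[[c Cc cx] /IH[d Cd ds]].
  have [e [Ce /asboolP[ce _] /asboolP[de _]]] := join _ _ Cc Cd.
  exists e => // y; rewrite in_cons => /orP[/eqP ->|/ds /de //]; exact: ce.
have /choice[f fP] : forall s, exists y, forall c, C c -> seq_in (coded c) s ->
    y = code c s.
  move=> s; have [[c [Cc cs]]|nc] := pselect (exists c, C c /\ seq_in (coded c) s).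
    exists (code c s) => d Cd ds.
    have [e [_ /asboolP[_ ce] /asboolP[_ de]]] := join _ _ Cc Cd.
    by rewrite -ce // de.
  by exists (code c1 s) => c Cc cs; case: nc; exists c.
have fX s : seq_in X s -> X (f s).
  by move=> /finX[c Cc cs]; exists c => //; rewrite (fP _ c) //; exact: code_in.
have fI s t : seq_in X s -> seq_in X t -> f s = f t -> s = t.
  move=> /finX[c Cc cs] /finX[d Cd dt].
  have [e [Ce /asboolP[ce _] /asboolP[de _]]] := join _ _ Cc Cd.
  have es : seq_in (coded e) s by move=> x /cs /ce.
  have et : seq_in (coded e) t by move=> x /dt /de.
  by rewrite (fP _ e) // (fP _ e) //; exact: code_inj.
have X0 : X x0 by exists c1 => //; exact: coded0.
have X1 : X x1 by exists c1 => //; exact: coded1.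
exists (SeqCoding X f X0 X1 fX fI) => c Cc; apply/asboolP; split => [x cx|s cs] /=.
  by exists c.
exact: fP.
Qed.

(** Let X be the set coded by a maximal partial coding. If the complement of X
injects into X, sequences in J are rewritten as sequences of tagged elements of X
and then coded. Otherwise X injects into its complement by some h; the sequences
in X and h(X) that are not contained in X can be given codes in h(X), which
contradicts maximality. *)
Lemma seq_coding_total : seq_coding -> exists f : seq J -> J, injective f.
Proof.
move=> c0.
have [||d dmax] := ZL_preorder c0 _ _ (extends_chain c0).
- by move=> c; apply/asboolP; split.
- move=> b c d /asboolP[bc fbc] /asboolP[cd fcd]; apply/asboolP; split.
    exact: subset_trans cd.
  by move=> s bs; rewrite fcd ?fbc // => x /bs /bc.
set X := coded d; have X0 : X x0 := coded0 d; have X1 : X x1 := coded1 d.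
have [[g gX gI]|[h hX hI]] := injection_total _ _ (~` X) X x0 x0.
  exists (fun s => code d (flatten (map (tag_code X g) s))) => s t.
  have gX' : set_fun ([set: J] `\` X) X g by rewrite setTD.
  have gI' : set_inj ([set: J] `\` X) g by rewrite setTD.
  move=> /code_inj => /(_ (tag_code_in _ [set: J] _ _ X0 X1 gX' (fun _ _ => I))).
  move=> /(_ (tag_code_in _ [set: J] _ _ X0 X1 gX' (fun _ _ => I))).
  apply: (flatten_pairs_inj [set: J] _ _ _ (tag_code2 X g)) => //; exact: tag_code_inj.
exfalso.
(* X embeds into its complement: the coding extends to Y *)
pose Y := X `|` h @` X.
have /choice[g gP] : forall y, exists x, (h @` X) y -> X x /\ h x = y.
  move=> y; have [[x Xx <-]|ny] := pselect ((h @` X) y); first by exists x.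
  by exists x0.
have gX : set_fun (Y `\` X) X g by move=> y [[//|/gP[]]].
have gI : set_inj (Y `\` X) g.
  move=> y z /set_mem[[//|/gP[_ yE]] _] /set_mem[[//|/gP[_ zE]] _] gyz.
  by rewrite -yE gyz zE.
pose f s := if `[< seq_in X s >] then code d s
            else h (code d (flatten (map (tag_code X g) s))).
have codeX s : seq_in Y s -> X (code d (flatten (map (tag_code X g) s))).
  by move=> Ys; apply: code_in; apply: tag_code_in Ys.
have fY s : seq_in Y s -> Y (f s).
  move=> Ys; rewrite /f; case: asboolP => Xs; first by left; exact: code_in.
  by right; exists (code d (flatten (map (tag_code X g) s))) => //; exact: codeX.
have fI s t : seq_in Y s -> seq_in Y t -> f s = f t -> s = t.
  move=> Ys Yt; rewrite /f; case: asboolP => Xs; case: asboolP => Xt.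
  - exact: code_inj.
  - by move=> E; case: (hX _ (codeX _ Yt)); rewrite -E; exact: code_in.
  - by move=> E; case: (hX _ (codeX _ Ys)); rewrite E; exact: code_in.
  - move=> /(hI _ _ (mem_set (codeX _ Ys)) (mem_set (codeX _ Yt))).
    move=> /code_inj => /(_ (tag_code_in _ _ _ _ X0 X1 gX Ys)).
    move=> /(_ (tag_code_in _ _ _ _ X0 X1 gX Yt)).
    by apply: (flatten_pairs_inj Y _ _ _ (tag_code2 X g)) => //; exact: tag_code_inj.
pose d' := SeqCoding Y f (or_introl X0) (or_introl X1) fY fI.
have /dmax /asboolP[YX _] : extends d d'.
  apply/asboolP; split=> [x Xx|s Xs]; first by left.
  by rewrite /= /f; case: asboolP.
apply: (hX x0 X0); apply: YX; right; by exists x0.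
Qed.

End Coding.

(** Sequences of natural numbers are countable, so that an infinite countable
subset of J carries a partial coding from which to start. *)
Lemma infinite_seq_inj : infinite_set [set: J] ->
  exists f : seq J -> J, injective f.
Proof.
move=> /infiniteP /card_leP[g].
pose e n := val (g (SigSub (mem_set (I : [set: nat] n)))).
have eI : injective e.
  by move=> m n /val_inj /(inj (mem_set I) (mem_set I)) [].
pose X := range e.
have /choice[e' e'K] : forall x, exists n, X x -> e n = x.
  by move=> x; have [[n _ <-]|nx] := pselect (X x); [exists n|exists 0%N].
pose f s := e (choice.pickle (map e' s)).
have fI s t : seq_in X s -> seq_in X t -> f s = f t -> s = t.
  move=> Xs Xt /eI /(pcan_inj choice.pickleK) st.
  rewrite -(map_id s) -(map_id t).
  have -> : map id s = map e (map e' s).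
    by rewrite -map_comp; apply/eq_in_map => x /Xs /e'K.
  by rewrite st -map_comp; apply/eq_in_map => x /Xt /e'K.
have e01 : e 0%N <> e 1%N by move=> /eI.
exact: (seq_coding_total _ _ e01
  (SeqCoding _ _ X f (imageP e I) (imageP e I) (fun s _ => imageP e I) fI)).
Qed.

End FiniteSequences.

(** * Maximal ideals and residue fields *)

Section MaximalIdeals.
Variable B : comNzRingType.
Implicit Types a m : set B.

Lemma ideal0 a : is_ideal a -> a 0. Proof. by case. Qed.
Lemma idealD a x y : is_ideal a -> a x -> a y -> a (x + y).
Proof. by case=> _ _ aD _; exact: aD. Qed.
Lemma idealM a r x : is_ideal a -> a x -> a (r * x).
Proof. by case=> _ _ _ aM; exact: aM. Qed.
Lemma idealN a x : is_ideal a -> a x -> a (- x).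
Proof. by move=> ia ax; rewrite -mulN1r; exact: idealM. Qed.
Lemma idealB a x y : is_ideal a -> a x -> a y -> a (x - y).
Proof. by move=> ia ax ay; apply: idealD => //; exact: idealN. Qed.
Lemma idealBM a x y u v : is_ideal a -> a (x - u) -> a (y - v) -> a (x * y - u * v).
Proof.
move=> ia axu ayv; rewrite -[X in a X](subrKA (x * v)) -mulrBr -mulrBl [X in _ + X]mulrC.
by apply: idealD => //; exact: idealM.
Qed.

Lemma proper_idealP a : is_ideal a -> a <> [set: B] <-> ~ a 1.
Proof.
move=> ia; split; last by move=> na1 aT; apply: na1; rewrite aT.
by move=> aT a1; apply: aT; apply/seteqP; split=> // x _; rewrite -[x]mulr1; exact: idealM.
Qed.

(** The lemma on unions of chains is applied to the sets b for which the union of a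
and b is a proper ideal; in this way the empty chain also has an upper
bound. *)
Lemma maximal_ideal_exists a : is_ideal a -> a <> [set: B] ->
  exists2 m, Smax m & a `<=` m.
Proof.
move=> ia /(proper_idealP _ ia) na1.
pose P b := is_ideal (a `|` b) /\ ~ (a `|` b) 1.
have [|b [[ib nb1] bmax]] := @Zorn_bigcup _ P.
  move=> C CP Ctot.
  have join x y : (a `|` \bigcup_(b in C) b) x -> (a `|` \bigcup_(b in C) b) y ->
      (a x /\ a y) \/ exists2 b, C b & (a `|` b) x /\ (a `|` b) y.
    move=> [ax|[b Cb bx]] [ay|[c Cc cy]]; first by left.
    - by right; exists c => //; split; [left|right].
    - by right; exists b => //; split; [right|left].
    - right; have [bc|cb] := Ctot _ _ Cb Cc.
        by exists c => //; split; right => //; exact: bc.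
      by exists b => //; split; right => //; exact: cb.
  have sub b : C b -> a `|` b `<=` a `|` \bigcup_(b in C) b.
    by move=> Cb; apply: setUS => x bx; exists b.
  split; last by case=> // -[b Cb b1]; case: (CP _ Cb) => _; apply; right.
  split=> //.
  - by left; exact: ideal0.
  - move=> x y /join/[apply] -[[ax ay]|[b Cb [bx byy]]]; first by left; exact: idealD.
    by apply: (sub _ Cb); apply: idealD => //; case: (CP _ Cb).
  - move=> r x _ [ax|[b Cb bx]]; first by left; exact: idealM.
    by apply: (sub _ Cb); apply: idealM; [case: (CP _ Cb)|right].
exists (a `|` b); last by left.
split=> //; first exact/proper_idealP.
move=> c ic bc; have [c1|nc1] := pselect (c 1).
  right; apply/seteqP; split=> // x _; rewrite -[x]mulr1; exact: idealM.
left; apply/seteqP; split=> // x cx; apply: contrapT => nx.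
have cE : a `|` c = c by apply/setUidr => y ay; apply: bc; left.
apply: (bmax c); last by rewrite /P cE.
split; first by move=> y byy; apply: bc; right.
by move=> /(_ x cx) bx; apply: nx; right.
Qed.

Lemma Smax_ideal m : Smax m -> is_ideal m. Proof. by case. Qed.
Lemma Smax_proper m : Smax m -> ~ m 1.
Proof. by case=> im /(proper_idealP _ im). Qed.

Lemma Smax_inv m x : Smax m -> ~ m x -> exists r, m (1 - r * x).
Proof.
move=> [im _ mmax] nx; pose b := [set y | exists r, m (y - r * x)].
have ib : is_ideal b.
  split=> //.
  - by exists 0; rewrite mul0r subr0; exact: ideal0.
  - move=> y z [r ry] [s sz]; exists (r + s).
    by rewrite mulrDl opprD addrACA; exact: idealD.
  - by move=> r y _ [s sy]; exists (r * s); rewrite -mulrA -mulrBr; exact: idealM.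
have mb : m `<=` b by move=> y my; exists 0; rewrite mul0r subr0.
have bx : b x by exists 1; rewrite mul1r subrr; exact: ideal0.
case: (mmax b ib mb) => bE; first by case: nx; rewrite -bE.
by have : b 1 by rewrite bE.
Qed.

End MaximalIdeals.

Lemma ideal_preimage (A B : comNzRingType) (h : {rmorphism A -> B}) (a : set B) :
  is_ideal a -> is_ideal (h @^-1` a).
Proof.
move=> ia; split=> // [|x y|r x _] /=; first by rewrite rmorph0; exact: ideal0.
  by rewrite rmorphD; exact: idealD.
by rewrite rmorphM; exact: idealM.
Qed.

(** This turns a bare proof that R is a field into the field structure, in a form that
can be substituted for R. *)
Lemma fieldE (R : comNzRingType) : is_field R ->
  exists F : fieldType, F = R :> comNzRingType.
Proof.
move=> fR.
have /choice[inv invP] : forall x : R, exists y : R, (x != 0 -> y * x = 1) /\ (x = 0 -> y = 0).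
  move=> x; have [->|/[dup] xn0 /fR[y xy]] := eqVneq x 0; first by exists 0; split.
  exists y; split; first by rewrite mulrC.
  by move=> x0; rewrite x0 eqxx in xn0.
have mulV : forall x : R, x != 0 -> inv x * x = 1 by move=> x; case: (invP x).
have inv0 : inv 0 = 0 by case: (invP 0) => _; apply.
case: R fR inv {invP} mulV inv0 => T c fR inv mulV inv0.
pose R := GRing.ComNzRing.Pack c.
pose M := GRing.ComNzRing_isField.Build R mulV inv0.
pose F : fieldType := HB.pack (GRing.ComNzRing.sort R) M.
by exists F.
Qed.

Local Open Scope quotient_scope.

Lemma quotient_eq0 (B : comNzRingType) (b : idealr B) (x : B) :
  (\pi_({ideal_quot b}) x = 0) <-> x \in b.
Proof.
rewrite -{2}[x]subr0 Quotient.idealrBE -(rmorph0 \pi_({ideal_quot b})).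
by split=> [->|/eqP].
Qed.

Lemma quotient_is_field (B : comNzRingType) (b : idealr B) :
  Smax [set` b] -> is_field {ideal_quot b}.
Proof.
move=> mb y; rewrite -[y]reprK; set x := repr y => yn0.
have nx : ~ [set` b] x by move=> /= /quotient_eq0 x0; rewrite x0 eqxx in yn0.
have [r /quotient_eq0] := Smax_inv _ _ _ mb nx.
rewrite rmorphB rmorph1 rmorphM => /eqP; rewrite subr_eq0 => /eqP E.
by exists (\pi r); rewrite mulrC -E.
Qed.

Lemma Smax_idealr (B : comNzRingType) (m : set B) :
  Smax m -> exists b : idealr B, m = [set` b].
Proof. by move=> [im mT _]; exact: (idealrP m).1. Qed.

Lemma residue_field (B : comNzRingType) (m : set B) : Smax m ->
  exists2 K : comNzRingType, is_field K & exists2 pi : {rmorphism B -> K},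
    forall y, exists b, pi b = y & forall b, pi b = 0 <-> m b.
Proof.
move=> /[dup] /Smax_idealr[b ->] mb; exists {ideal_quot b}; first exact: quotient_is_field.
exists (\pi_({ideal_quot b})); last by move=> x; exact: quotient_eq0.
by move=> y; exists (repr y); exact: reprK.
Qed.

Lemma closed_field_infinite (F : fieldType) :
  GRing.closed_field_axiom F -> infinite_set [set: F].
Proof.
move=> closedF finF.
have [x] : exists x, ~~ root (\prod_(c <- fset_set [set: F]) ('X - c%:P)) x.
  by apply/(PreClosedField.closed_nonrootP closedF)/monic_neq0/monic_prod_XsubC.
by rewrite root_prod_XsubC => /negP; apply; rewrite in_fset_set // in_setT.
Qed.

(** If all these sets were finite, an element c of F would be determined by the
sequence s c and by its rank among the finitely many d with s d contained in s c;
both can be coded by an element of J. *)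
Lemma infinite_fiber_of_seq (F J : choiceType) (s : F -> seq J) :
    infinite_set [set: F] -> ~ ([set: F] #<= [set: J])%card ->
  exists t : seq J, infinite_set [set c | {subset s c <= t}].
Proof.
move=> infF FJ; have [finJ|infJ] := pselect (finite_set [set: J]).
  exists (fset_set [set: J]); apply: sub_infinite_set infF => c _ x _.
  by rewrite in_fset_set // inE.
apply: contrapT => /forallNP fin; apply: FJ.
have {}fin (t : seq J) : finite_set [set c | {subset s c <= t}] by exact: contrapT (fin t).
have [e eI] := infinite_seq_inj _ infJ.
have [j0 _] := infinite_setN0 infJ.
pose n c := index c (fset_set [set d | {subset s d <= s c}]).
pose f c := e [:: e (s c); e (nseq (n c) j0)].
suff fI : injective f.
  have /injfunPex[g] : exists2 f : F -> J,
      set_fun [set: F] [set: J] f & set_inj [set: F] f.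
    by exists f => // x y _ _ /fI.
  exact: inj_card_le g.
move=> c d /eI[] /eI scd /eI /(congr1 size); rewrite !size_nseq /n scd => ncd.
have in_fib x : s x = s d -> x \in fset_set [set y | {subset s y <= s d}].
  by move=> sx; rewrite in_fset_set ?inE /= ?sx.
by rewrite -(nth_index c (in_fib c scd)) ncd nth_index // in_fib.
Qed.

(** For t outside F, a single finite set of generators would yield inverses of
t - c for infinitely many c. *)
Lemma trivial_residue_extension (F K : fieldType) (iota : {rmorphism F -> K})
    (J : choiceType) (u : J -> K) :
    GRing.closed_field_axiom F -> ~ ([set: F] #<= [set: J])%card ->
    (forall y, adjoin (range iota `|` range u) y) ->
  forall y, exists c, iota c = y.
Proof.
move=> closedF FJ gen t; apply: contrapT => /forallNP tF.
have {}tF c : t <> iota c by move=> tE; apply: (tF c).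
have /choice[s sP] : forall c, exists s : seq J,
    adjoin (range iota `|` [set` map u s]) (t - iota c)^-1.
  by move=> c; exact: adjoin_finite_support.
have [r infr] := infinite_fiber_of_seq _ _ s (closed_field_infinite _ closedF) FJ.
apply: infr; have := finite_shifted_inverses _ _ closedF iota t (map u r) tF.
apply: sub_finite_set => c cr; exists (t - iota c)^-1.
  move: (sP c); apply: adjoinS; apply: setUS => _ /mapP[j /cr jr ->].
  by apply/mapP; exists j.
by rewrite divff // subr_eq0; apply/eqP.
Qed.

(** The residue field of m is F, and x j is the residue of u j. *)
Lemma rational_point (F B : comNzRingType) (iota : {rmorphism F -> B})
    (J : choiceType) (u : J -> B) (m : set B) :
    is_field F -> GRing.closed_field_axiom F -> ~ ([set: F] #<= [set: J])%card ->
    (forall y, adjoin (range iota `|` range u) y) -> Smax m ->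
  exists x : J -> F, forall j, m (u j - iota (x j)).
Proof.
move=> /fieldE[F' FE]; move: iota; case: _ / FE => {F} iota closedF FJ gen mm.
have [K /fieldE[K' KE]] := residue_field _ _ mm; case: _ / KE => {K} -[pi surj ker].
have gen' y : adjoin (range (pi \o iota) `|` range (pi \o u)) y.
  have [b <-] := surj y.
  apply: (adjoin_min _ _ (subring_preimage _ _ pi _ (subring_adjoin _)) _ b (gen b)).
  move=> _ [[c _ <-]|[j _ <-]]; apply: sub_adjoin; first by left; exists c.
  by right; exists j.
have /choice[x xP] : forall j, exists c, pi (iota c) = pi (u j).
  by move=> j; exact: (trivial_residue_extension _ _ (pi \o iota) _ _ closedF FJ gen').
by exists x => j; apply/ker; rewrite rmorphB xP subrr.
Qed.

(** * Evaluation and substitution in polynomial algebras *)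

Section Substitution.
Variables (F R : comNzRingType) (I : choiceType) (iota : {rmorphism F -> R}).
Variable u : I -> R.
Local Notation A := (polyalg F I).

Definition monom_value (m : {cmonom I}) : R := \prod_(i <- finsupp m) u i ^+ m i.

Lemma monom_valueEw (m : {cmonom I}) (d : {fset I}) :
  (finsupp m `<=` d)%fset -> monom_value m = \prod_(i <- d) u i ^+ m i.
Proof.
move=> md; rewrite /monom_value (big_fset_incl _ md) // => i _.
by rewrite -cmE_neq0 negbK => /eqP ->; rewrite expr0.
Qed.

Fact monom_value_mmorphism : mmorphism monom_value.
Proof.
split=> [m1 m2|]; last by rewrite /monom_value mdom1 big_seq_fset0.
rewrite {1}/monom_value mdomD.
rewrite (monom_valueEw _ _ (fsubsetUl _ (finsupp m2))).
rewrite (monom_valueEw _ _ (fsubsetUr (finsupp m1) _)).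
by rewrite -big_split /=; apply: eq_bigr => i _; rewrite cmM exprD.
Qed.

HB.instance Definition _ :=
  monalg.isMultiplicative.Build {cmonom I} R monom_value monom_value_mmorphism.

Definition substitute : {rmorphism A -> R} := mmap iota monom_value.

Lemma substitute_tvar i : substitute (tvar F i) = u i.
Proof.
rewrite /substitute /= mmapU /= rmorph1 mul1r.
by rewrite /monom_value mdomU big_seq_fset1 cmUU expr1.
Qed.

Lemma substitute_scale c f : substitute (c *: f) = iota c * substitute f.
Proof. by rewrite /substitute /= mmapZ. Qed.

Lemma substitute_scalar c : substitute c%:A = iota c.
Proof. by rewrite substitute_scale rmorph1 mulr1. Qed.

End Substitution.

Section PolynomialAlgebra.
Variables (F : comNzRingType) (I : choiceType).
Local Notation A := (polyalg F I).
Implicit Types (x : I -> F) (f g : A).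

Definition eval_at x : {rmorphism A -> F} := substitute F F I idfun x.

Lemma eval_atE x f : eval f x = eval_at x f. Proof. by []. Qed.

Lemma eval1 x : eval (1 : A) x = 1.
Proof. by rewrite eval_atE rmorph1. Qed.

Lemma evalD x f g : eval (f + g) x = eval f x + eval g x.
Proof. by rewrite eval_atE rmorphD. Qed.

Lemma evalB x f g : eval (f - g) x = eval f x - eval g x.
Proof. by rewrite eval_atE rmorphB. Qed.

Lemma evalM x f g : eval (f * g) x = eval f x * eval g x.
Proof. by rewrite eval_atE rmorphM. Qed.

Lemma eval_scale x c f : eval (c *: f) x = c * eval f x.
Proof. by rewrite !eval_atE /eval_at substitute_scale. Qed.

Lemma eval_scalar x c : eval (c%:A : A) x = c.
Proof. by rewrite eval_scale eval1 mulr1. Qed.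

Lemma eval_tvar x i : eval (tvar F i) x = x i.
Proof. by rewrite eval_atE /eval_at substitute_tvar. Qed.

Lemma monomialM (m n : {cmonom I}) :
  mkmalgU (mmul m n) 1 = mkmalgU m 1 * mkmalgU n 1 :> A.
Proof.
rewrite (malgMEw (d1 := [fset m]%fset) (d2 := [fset n]%fset)) ?msuppU_le //.
by rewrite !big_seq_fset1 !mcoeffUU mulr1.
Qed.

Lemma monomialZ (m : {cmonom I}) (c : F) :
  mkmalgU m c = (c%:A : A) * mkmalgU m 1.
Proof.
rewrite mulr_algl; apply/malgP => k; rewrite mcoeffZ.
apply: etrans (mcoeffU m c k) _.
by rewrite (mcoeffU m (1 : F) k) mulr_natr.
Qed.

(** Induction over polynomials: the monomials are reached by induction on the
degree. *)
Lemma polyalg_ind (S : set A) : subring_set S -> (forall c, S c%:A) ->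
  (forall i, S (tvar F i)) -> forall f, S f.
Proof.
move=> [S1 SB SM] Sc St f.
have S0 : S 0 by rewrite -(subrr 1); exact: SB.
have SD g h : S g -> S h -> S (g + h).
  by move=> Sg Sh; rewrite -[h]opprK; apply: (SB) => //; rewrite -sub0r; exact: SB.
have Smon n (m : {cmonom I}) : mdeg m = n -> S (mkmalgU m 1).
  elim: n m => [|n IH] m mE.
    by rewrite (mdeg_eq0I mE) -[mkmalgU _ _]/(malgC 1) mpolyC1E.
  (* split off one variable from a nontrivial monomial *)
  have [i mi] : exists i, m i != 0%N.
    apply: contrapT => /forallNP m0; suff m1 : m = mone by rewrite m1 mdeg1 in mE.
    by apply/eqP/cmP => i; rewrite cm1; apply/eqP/negPn/negP => /m0.
  have mM : m = mmul (ucm i) (divcm m (ucm i)).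
    apply/eqP/cmP => j; rewrite cmM divcmE cmU; case: eqP => [<-|_] /=.
      by rewrite subnKC // lt0n.
    by rewrite subn0.
  have -> : mkmalgU m (1 : F) = tvar F i * mkmalgU (divcm m (ucm i)) 1.
    by rewrite /tvar -monomialM -mM.
  apply: SM; first exact: St.
  by apply: IH; move: mE; rewrite {1}mM mdegM mdegU => -[].
rewrite (monalgE f); apply: (big_ind S S0 SD) => m _.
rewrite monomialZ; apply: SM; [exact: Sc|exact: Smon].
Qed.

Lemma tvars_generate f : adjoin (range (in_alg A) `|` range (@tvar F I)) f.
Proof.
apply: polyalg_ind => [|c|i]; first exact: subring_adjoin.
  by apply: sub_adjoin; left; exists c.
by apply: sub_adjoin; right; exists i.
Qed.

Lemma eval_unique (phi : {rmorphism A -> F}) : (forall c, phi c%:A = c) ->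
  forall f, eval f (fun i => phi (tvar F i)) = phi f.
Proof.
move=> scal; apply: polyalg_ind => [|c|i].
- split=> [|g h gx hx|g h gx hx].
  + by rewrite eval1 rmorph1.
  + by rewrite evalB gx hx rmorphB.
  + by rewrite evalM gx hx rmorphM.
- by rewrite eval_scalar scal.
- by rewrite eval_tvar.
Qed.

(** Modulo m, the algebra structure identifies each t_i with x_i, hence f with its
value at x. *)
Lemma polynomial_congruence (m : set A) x :
    is_ideal m -> (forall i, m (tvar F i - (x i)%:A)) ->
  forall f, m (f - (eval f x)%:A).
Proof.
move=> im mx; apply: (polyalg_ind [set g : A | m (g - (eval g x)%:A)]) => /=.
- split=> [|g k /= mg mk|g k /= mg mk] /=.
  + by rewrite eval_atE [eval_at x 1]rmorph1 scale1r subrr; exact: ideal0.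
  + rewrite !eval_atE [eval_at x _]rmorphB scalerBl opprD addrACA -opprD.
    exact: (idealB _ _ _ _ im mg mk).
  + rewrite !eval_atE in mg mk *.
    have -> : (eval_at x (g * k))%:A = (eval_at x g)%:A * (eval_at x k)%:A :> A.
      by rewrite rmorphM mulr_algl scalerA.
    exact: (idealBM _ _ _ _ _ _ im mg mk).
- by move=> c; rewrite eval_scalar subrr; exact: ideal0.
- by move=> i; rewrite eval_tvar.
Qed.

Lemma zero_set_full : zero_set [set: A] = set0.
Proof.
apply/seteqP; split=> // x /(_ 1 Logic.I); rewrite eval_atE rmorph1 => /eqP.
by rewrite oner_eq0.
Qed.

Lemma ideal_point x : is_ideal (@point_ideal F I x).
Proof.
split=> //.
- by move=> y ->; rewrite eval_atE rmorph0.
- move=> f g fx gx y yE.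
  by rewrite eval_atE rmorphD -!eval_atE fx // gx // addr0.
- by move=> f g _ gx y yE; rewrite eval_atE rmorphM -!eval_atE gx // mulr0.
Qed.

Lemma point_idealP x f : point_ideal x f <-> eval f x = 0.
Proof. by split=> [/(_ x erefl)|fx y ->]. Qed.

(** The value at x of an element of m is a constant in m, and nonzero constants are
invertible. *)
Lemma ideal_sub_point x (m : set A) : is_field F -> is_ideal m -> ~ m 1 ->
  (forall i, m (tvar F i - (x i)%:A)) -> m `<=` point_ideal x.
Proof.
move=> fF im nm1 mx f mf; apply/point_idealP/eqP/negPn/negP => /fF[c fc].
apply: nm1; have mfx : m (eval f x)%:A.
  rewrite -[X in m X](subKr f); apply: idealB => //.
  exact: polynomial_congruence.
have -> : 1 = c%:A * (eval f x)%:A :> A.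
  by rewrite -scalerAl mul1r scalerA mulrC fc scale1r.
exact: idealM.
Qed.

End PolynomialAlgebra.

(** * Zeros of ideals over algebraically closed fields of large cardinality *)

(** Take for b the ideal of {poly A} generated by a and 1 - f 'X. If 1 were congruent to
q (1 - f 'X) modulo a, comparing coefficients would show that the coefficient
of 'X^k in q is congruent to f ^+ k, and this coefficient vanishes for large k. *)
Lemma rabinowitsch (A : comNzRingType) (a : set A) (f : A) :
    is_ideal a -> (forall n, ~ a (f ^+ n)) ->
  exists b : set {poly A}, [/\ is_ideal b, ~ b 1, b (1 - f%:P * 'X)
    & forall g, a g -> b g%:P].
Proof.
move=> ia nf.
exists [set p | exists q : {poly A}, forall k, a (p - q * (1 - f%:P * 'X))`_k].
split.
- split=> //=.
  + by exists 0 => k; rewrite mul0r subrr coef0; exact: ideal0.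
  + move=> p p' [q qP] [q' qP']; exists (q + q') => k.
    by rewrite mulrDl opprD addrACA coefD; exact: idealD.
  + move=> r p _ [q qP]; exists (r * q) => k.
    rewrite -mulrA -mulrBr coefM; apply: big_ind => [|x y|i _]; first exact: ideal0.
      exact: idealD.
    exact: idealM.
- move=> [q qP]; apply: (nf (size q)).
  have coefE k : (1 - q * (1 - f%:P * 'X))`_k.+1 = - (q`_k.+1 - f * q`_k).
    by rewrite mulrBr mulr1 mulrA coefB coef1 sub0r coefB coefMX mulrC coefCM.
  (* modulo a, q is the geometric series with ratio f 'X *)
  have pow k : a (f ^+ k - q`_k).
    elim: k => [|k IH].
      by have := qP 0; rewrite mulrBr mulr1 mulrA coefB coef1 coefB coefMX subr0.
    have -> : f ^+ k.+1 - q`_k.+1 = f * (f ^+ k - q`_k) + - (q`_k.+1 - f * q`_k).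
      by rewrite mulrBr -exprS opprB addrA subrK.
    by apply: idealD; [|exact: idealM|rewrite -coefE].
  by have := pow (size q); rewrite nth_default // subr0.
- by exists 1 => k; rewrite mul1r subrr coef0; exact: ideal0.
- move=> g ag; exists 0 => k; rewrite mul0r subr0 coefC.
  by case: eqP => // _; exact: ideal0.
Qed.

Section Nullstellensatz.
Variables (F : fieldType) (I : choiceType).
Local Notation A := (polyalg F I).

Lemma zero_set_nonempty (a : set A) :
    GRing.closed_field_axiom F -> ~ ([set: F] #<= [set: I])%card ->
    is_ideal a -> ~ a 1 ->
  exists x, zero_set a x.
Proof.
move=> closedF FI ia /(proper_idealP _ _ ia) aT.
have [m mm am] := maximal_ideal_exists _ _ ia aT.
have fF : is_field F by move=> c c0; exists c^-1; rewrite divff.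
have [x xP] := rational_point _ _ _ _ _ _ fF closedF FI (@tvars_generate F I) mm.
exists x => f /am mf; apply/(point_idealP _ _ x).
exact: (ideal_sub_point _ _ x m fF (Smax_ideal _ _ mm) (Smax_proper _ _ mm) xP).
Qed.

(** For infinite I, an option is a sequence of length at most one, and these inject
into I. *)
Lemma not_card_le_option : infinite_set [set: F] ->
  ~ ([set: F] #<= [set: I])%card -> ~ ([set: F] #<= [set: option I])%card.
Proof.
move=> infF FI Fo; apply: FI.
have [finI|infI] := pselect (finite_set [set: I]).
  case: infF; apply: card_le_finite Fo _.
  have -> : [set: option I] = None |` (Some @` [set: I]).
    by apply/seteqP; split=> // -[i|] _; [right; exists i|left].
  by rewrite finite_setU; split; [exact: finite_set1|exact: finite_image].
apply: card_le_trans Fo _; have [e eI] := infinite_seq_inj _ infI.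
pose f (o : option I) := e (seq_of_opt o).
have /injfunPex[g] : exists2 f : option I -> I,
    set_fun [set: option I] [set: I] f & set_inj [set: option I] f.
  by exists f => // -[i|] [j|] _ _ /eI // [->].
exact: inj_card_le g.
Qed.

Lemma poly_polyalg_generate (p : {poly A}) :
  adjoin (range (polyC \o in_alg A)
    `|` range (oapp (fun i => (tvar F i)%:P) ('X : {poly A}))) p.
Proof.
set X := _ `|` _; have [S1 SB SM] := subring_adjoin X.
have SC (f : A) : adjoin X f%:P.
  apply: (polyalg_ind _ _ (polyC @^-1` adjoin X)) => [|c|i].
  - exact: subring_preimage.
  - by apply: sub_adjoin; left; exists c.
  - by apply: sub_adjoin; right; exists (Some i).
elim/poly_ind: p => [|p c IH]; first exact: SC.
rewrite -[c%:P]opprK; apply: (SB); last by rewrite -polyCN; exact: SC.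
by apply: SM => //; apply: sub_adjoin; right; exists None.
Qed.

(** A function f vanishing on the zero set of a, but without a power in a, would
give a point of a maximal ideal containing a and 1 - f 'X; at this point f vanishes,
so that 1 would be in the ideal. *)
Lemma strong_nullstellensatz (a : set A) :
    GRing.closed_field_axiom F -> ~ ([set: F] #<= [set: I])%card -> is_ideal a ->
  radical a = vanishing_ideal (zero_set a).
Proof.
move=> closedF FI ia; apply/seteqP; split=> f.
  move=> [n afn] x /(_ _ afn); rewrite !eval_atE rmorphXn => /eqP.
  by rewrite expf_eq0 => /andP[_ /eqP].
move=> fV; apply: contrapT => nf.
have [b [ib nb1 bf ab]] := rabinowitsch _ a f ia (fun n afn => nf (ex_intro _ n afn)).
have [m mm bm] := maximal_ideal_exists _ b ib ((proper_idealP _ _ ib).2 nb1).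
have fF : is_field F by move=> c c0; exists c^-1; rewrite divff.
have FoI := not_card_le_option (closed_field_infinite _ closedF) FI.
have [y yP] := rational_point _ _ _ _ _ _ fF closedF FoI poly_polyalg_generate mm.
have im := Smax_ideal _ _ mm; have nm1 := Smax_proper _ _ mm.
pose x i := y (Some i).
pose m' : set A := polyC @^-1` m.
have im' : is_ideal m' by exact: ideal_preimage.
have m'x i : m' (tvar F i - (x i)%:A).
  by have := yP (Some i); rewrite /m' /= polyCB.
have m'sub : m' `<=` point_ideal x by exact: ideal_sub_point.
have fx : eval f x = 0.
  by apply: fV => g /ab /bm m'g; apply/(point_idealP _ _ x); exact: m'sub.
have m'f : m' f.
  by have := polynomial_congruence _ _ m' x im' m'x f; rewrite fx scale0r subr0.
apply: nm1; rewrite -(subrK (f%:P * 'X) 1) mulrC; apply: idealD => //.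
  by rewrite mulrC; exact: bm.
exact: idealM.
Qed.

End Nullstellensatz.

(** * Necessity of algebraic closure and large cardinality *)

Section FiniteRelations.
Variables (F : comNzRingType) (I : choiceType).
Local Notation A := (polyalg F I).

(** The denominator of c must vanish at 1 / c, so that no value of s can be used for
all c. The one of c = 1 also excludes the values 0 and 1. *)
Definition reciprocal_den (c s : F) : F := if c == 1 then s * (1 - s) else 1 - c * s.

Definition reciprocal_relation (phi : F -> I) (c : F) : A :=
  let t := tvar F (phi 0) in
  tvar F (phi c) * (if c == 1 then t - t * t else 1 - c *: t) - 1.

Lemma eval_reciprocal_relation phi c x : eval (reciprocal_relation phi c) x =
  x (phi c) * reciprocal_den c (x (phi 0)) - 1.
Proof.
rewrite /reciprocal_relation /reciprocal_den evalB eval1 evalM eval_tvar.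
case: eqP => _; first by rewrite evalB evalM eval_tvar [x (phi 0) * (1 - _)]mulrBr mulr1.
by rewrite evalB eval1 eval_scale eval_tvar.
Qed.

(** This ideal contains the one generated by the relations, and it is defined so that
solvability of each finite part of the relations refutes membership of 1 at
once. *)
Definition finite_consequences (T : eqType) (P : set T) (rel : T -> A) : set A :=
  [set f | exists l : seq T, forall x,
    (forall c, c \in l -> P c -> eval (rel c) x = 0) -> eval f x = 0].

Lemma ideal_finite_consequences (T : eqType) (P : set T) (rel : T -> A) :
  is_ideal (finite_consequences T P rel).
Proof.
split=> // [|f g [l lf] [k kg]|r f _ [l lf]].
- by exists [::] => x _; rewrite eval_atE rmorph0.
- exists (l ++ k) => x xlk.
  by rewrite evalD lf ?kg ?addr0 // => c cl; apply: xlk; rewrite mem_cat cl ?orbT.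
- by exists l => x /lf fx; rewrite evalM fx mulr0.
Qed.

End FiniteRelations.

Section Converse.
Variables (F : fieldType) (I : choiceType).
Local Notation A := (polyalg F I).
Hypothesis weak : forall a : set A, is_ideal a -> ~ a 1 -> exists x, zero_set a x.

Let diagonal : {rmorphism A -> {poly F}} :=
  substitute F {poly F} I polyC (fun=> 'X).

(** The ideal consists of the elements that become multiples of p when all variables
are sent to 'X. It is proper for reasons of degree, and a zero of it has a root
of p as its coordinate at i0. *)
Lemma closed_of_weak_nullstellensatz : inhabited I -> GRing.closed_field_axiom F.
Proof.
move=> [i0] n P n0; pose t : A := tvar F i0.
pose g : A := t ^+ n - \sum_(i < n) P i *: t ^+ i.
pose p : {poly F} := 'X^n - \poly_(i < n) P i.
have gp : diagonal g = p.
  rewrite /g rmorphB rmorphXn substitute_tvar rmorph_sum /= /p poly_def; congr (_ - _).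
  by apply: eq_bigr => i _; rewrite substitute_scale rmorphXn substitute_tvar mul_polyC.
have sp : size p = n.+1.
  by rewrite size_polyDl ?size_polyXn // size_polyN ltnS size_poly.
pose a : set A := [set f | exists q, diagonal f = q * p].
have ia : is_ideal a.
  split=> // [|f h [q qE] [r rE]|r f _ [q qE]].
  - by exists 0; rewrite rmorph0 mul0r.
  - by exists (q + r); rewrite rmorphD qE rE mulrDl.
  - by exists (diagonal r * q); rewrite rmorphM qE mulrA.
have na1 : ~ a 1.
  move=> [q]; rewrite rmorph1 => /(congr1 (size \o polyseq))/= /esym/eqP.
  by rewrite size_poly1 size_mul_eq1 sp eqSS => /andP[_ /eqP n00]; rewrite n00 in n0.
have [x xa] := weak a ia na1.
have /xa : a g by exists 1; rewrite mul1r.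
rewrite /g eval_atE rmorphB rmorphXn rmorph_sum -eval_atE eval_tvar => /eqP.
rewrite subr_eq0 => /eqP xE; exists (x i0); rewrite xE; apply: eq_bigr => i _.
by rewrite -eval_atE eval_scale eval_atE rmorphXn -eval_atE eval_tvar.
Qed.

(** For an injection phi of F into I, a solution of all the relations of
[reciprocal_relation] would have no possible value at phi 0, whereas a finite
number of them is solved by giving t_phi(0) a value s at which no denominator
vanishes and t_phi(c) the inverse of the denominator of c. *)
Lemma not_card_le_of_weak_nullstellensatz :
  GRing.closed_field_axiom F -> ~ ([set: F] #<= [set: I])%card.
Proof.
move=> closedF /card_leP[phi'].
pose phi (c : F) := val (phi' (SigSub (mem_set (Logic.I : [set: F] c)))).
have phiI : injective phi.
  by move=> c d /val_inj /(inj (mem_set Logic.I) (mem_set Logic.I)) [].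
pose rel := reciprocal_relation F I phi; pose den := reciprocal_den F.
have eval_rel c x : eval (rel c) x = x (phi c) * den c (x (phi 0)) - 1.
  exact: eval_reciprocal_relation.
pose a := finite_consequences F I F [set c | c != 0] rel.
have ia : is_ideal a by exact: ideal_finite_consequences.
have [x xa] : exists x, zero_set a x.
  apply: weak => // -[l l1].
  (* these contain all values of s at which the denominator of an element of l vanishes *)
  pose bad := [:: 0; 1] ++ map GRing.inv l.
  have [s] : exists s, ~~ root (\prod_(c <- bad) ('X - c%:P)) s.
    by apply/(PreClosedField.closed_nonrootP closedF)/monic_neq0/monic_prod_XsubC.
  rewrite root_prod_XsubC /bad !inE !negb_or => /and3P[s0 s1 sl].
  have /choice[psi psiP] : forall i, exists c, forall d, phi d = i -> c = d.
    move=> i; have [[d <-]|nd] := pselect (exists d, phi d = i).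
      by exists d => e /phiI.
    by exists 0 => d di; case: nd; exists d.
  have phiK c : psi (phi c) = c by exact: psiP.
  pose x i := if psi i == 0 then s else (den (psi i) s)^-1.
  suff xrel : forall c, c \in l -> c != 0 -> eval (rel c) x = 0.
    by have /eqP := l1 x xrel; rewrite eval1 oner_eq0.
  move=> c cl c0; rewrite eval_rel /x !phiK eqxx (negPf c0) mulVf ?subrr //.
  rewrite /den /reciprocal_den; case: ifPn => c1.
    by rewrite mulf_neq0 // subr_eq0 eq_sym.
  rewrite subr_eq0 eq_sym; apply: contra sl => /eqP cs; apply/mapP; exists c => //.
  by rewrite -[s](mulKf c0) [c * s]cs mulr1.
have xrel c : c != 0 -> x (phi c) * den c (x (phi 0)) = 1.
  move=> c0; have /xa/eqP : a (rel c) by exists [:: c] => y; apply; rewrite ?mem_seq1.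
  by rewrite eval_rel subr_eq0 => /eqP.
set s := x (phi 0) in xrel.
have := xrel 1 (oner_neq0 _); rewrite /den /reciprocal_den eqxx.
have [->|s0] := eqVneq s 0; first by rewrite mul0r mulr0 => /esym/eqP; rewrite oner_eq0.
have [->|s1 _] := eqVneq s 1.
  by rewrite subrr !mulr0 => /esym/eqP; rewrite oner_eq0.
have := xrel s^-1 (invr_neq0 s0); rewrite /den /reciprocal_den invr_eq1 (negPf s1).
by rewrite mulVf // subrr mulr0 => /esym/eqP; rewrite oner_eq0.
Qed.

Lemma weak_nullstellensatz_converse : inhabited I ->
  GRing.closed_field_axiom F /\ card_lt [set: I] [set: F].
Proof.
move=> hI; have closedF := closed_of_weak_nullstellensatz hI.
have FI := not_card_le_of_weak_nullstellensatz closedF; split=> //; split=> //.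
case: hI => i0.
have [[f _ fI]|[g _ gI]] := injection_total _ _ [set: I] [set: F] i0 0.
  have /injfunPex[f'] : exists2 f : I -> F,
      set_fun [set: I] [set: F] f & set_inj [set: I] f by exists f.
  exact: inj_card_le f'.
have /injfunPex[g'] : exists2 g : F -> I,
    set_fun [set: F] [set: I] g & set_inj [set: F] g by exists g.
by case: FI; exact: inj_card_le g'.
Qed.

End Converse.

(** * Subalgebras and ideals of points *)

Section Subalgebras.
Variables (R : comNzRingType) (B : comAlgType R).
Implicit Types (S X : set B).

Definition subalgebra S :=
  [/\ S 1, forall c f g, S f -> S g -> S (c *: f + g)
    & forall f g, S f -> S g -> S (f * g)].

Lemma subalg_closedE S : GRing.subalg_closed (mem S) <-> subalgebra S.
Proof.
split=> [[S1 SL SM]|[S1 SL SM]].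
  split=> [|c f g /mem_set Sf /mem_set Sg|f g /mem_set Sf /mem_set Sg].
  - exact: set_mem S1.
  - by apply: set_mem; exact: SL.
  - by apply: set_mem; exact: SM.
split=> [|c f g /set_mem Sf /set_mem Sg|f g /set_mem Sf /set_mem Sg]; apply: mem_set.
- exact: S1.
- exact: SL.
- exact: SM.
Qed.

Lemma gen_subalg_min X S : subalgebra S -> X `<=` S -> gen_subalg X `<=` S.
Proof. by move=> SS XS; apply: smallest_sub => //; apply/subalg_closedE. Qed.

Lemma sub_gen_subalg X : X `<=` gen_subalg X.
Proof. exact: sub_gen_smallest. Qed.

Lemma subalgebra_gen X : subalgebra (gen_subalg X).
Proof.
split=> [S [/subalg_closedE[S1 _ _] _]//|c f g Sf Sg S SS|f g Sf Sg S SS].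
  have [/subalg_closedE[_ SL _] _] := SS; apply: SL; [exact: Sf|exact: Sg].
have [/subalg_closedE[_ _ SM] _] := SS; apply: SM; [exact: Sf|exact: Sg].
Qed.

Lemma subalgebra0 S : subalgebra S -> S 0.
Proof. by move=> [S1 SL _]; have := SL (-1) 1 1 S1 S1; rewrite scaleN1r addNr. Qed.

Lemma subalgebraZ S c f : subalgebra S -> S f -> S (c *: f).
Proof.
by move=> SS Sf; rewrite -[_ *: _]addr0; case: (SS) => _ SL _; apply: SL => //;
  exact: subalgebra0.
Qed.

Lemma subalgebraB S f g : subalgebra S -> S f -> S g -> S (f - g).
Proof. by move=> [_ SL _] Sf Sg; rewrite addrC -scaleN1r; exact: SL. Qed.

Lemma subalgebra_subring S : subalgebra S -> subring_set S.
Proof. by move=> SS; split=> [|f g|]; [case: SS|exact: subalgebraB|case: SS]. Qed.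

Lemma subalgebra_scalars : subalgebra (range (fun c : R => c%:A : B)).
Proof.
split=> [|c _ _ [d _ <-] [e _ <-]|_ _ [d _ <-] [e _ <-]].
- by exists 1 => //; rewrite scale1r.
- by exists (c * d + e) => //; rewrite scalerA -scalerDl.
- by exists (d * e) => //; rewrite mulr_algl scalerA.
Qed.

Lemma ideal_of_gen_ideal S X : subalgebra S -> X `<=` S ->
  ideal_of S (gen_ideal S X).
Proof.
move=> SS XS; have iS : ideal_of S S.
  split=> //; first exact: subalgebra0.
    by move=> f g Sf Sg; rewrite -[f]scale1r; case: SS => _ SL _; exact: SL.
  by case: SS.
split.
- exact: smallest_sub.
- by move=> J [[_ J0 _ _] _].
- by move=> f g Jf Jg J JJ; have [[_ _ JD _] _] := JJ; apply: JD; [exact: Jf|exact: Jg].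
- by move=> r f Sr Jf J JJ; have [[_ _ _ JM] _] := JJ; apply: JM => //; exact: Jf.
Qed.

End Subalgebras.

Section PointIdeals.
Variables (F : comNzRingType) (I : choiceType).
Local Notation A := (polyalg F I).
Implicit Types (x : I -> F).

Lemma point_ideal_proper x : ~ @point_ideal F I x 1.
Proof. by move=> /point_idealP/eqP; rewrite eval1 oner_eq0. Qed.

Lemma point_ideal_tvar x i : point_ideal x (tvar F i - (x i)%:A).
Proof. by apply/point_idealP; rewrite evalB eval_tvar eval_scalar subrr. Qed.

Lemma point_ideal_Smax x : is_field F -> Smax (@point_ideal F I x).
Proof.
move=> fF; split; first exact: ideal_point.
  by apply/proper_idealP; [exact: ideal_point|exact: point_ideal_proper].
move=> a ia xa; have [a1|na1] := pselect (a 1).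
  by right; apply/seteqP; split=> // f _; rewrite -[f]mulr1; exact: idealM.
left; apply/seteqP; split=> //.
by apply: ideal_sub_point => // i; apply: xa; exact: point_ideal_tvar.
Qed.

Lemma point_ideal_inj : injective (@point_ideal F I).
Proof.
move=> x y xy; apply/funext => i.
have := point_ideal_tvar x i; rewrite xy => /point_idealP/eqP.
by rewrite evalB eval_tvar eval_scalar subr_eq0 => /eqP.
Qed.

Lemma Smax_point (m : set A) x : Smax m -> m `<=` point_ideal x -> m = point_ideal x.
Proof.
move=> [_ _ mmax] mx; case: (mmax _ (ideal_point _ _ x) mx) => // xT.
by case: (point_ideal_proper x); rewrite xT.
Qed.

Lemma field_of_Smax x : Smax (@point_ideal F I x) -> is_field F.
Proof.
move=> mx c c0; have nc : ~ point_ideal x (c%:A : A).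
  by move=> /point_idealP; rewrite eval_scalar => /eqP; rewrite (negPf c0).
have [r /point_idealP] := Smax_inv _ _ _ mx nc.
rewrite evalB eval1 evalM eval_scalar mulrC => /eqP; rewrite subr_eq0 => /eqP E.
by exists (eval r x).
Qed.

(** For nonzero c, the polynomials whose value at the origin is a multiple of c form
an ideal. It is not contained in the ideal of a point, as it contains the
constant c; so it is not proper, and c is invertible. *)
Lemma field_of_maximal_points :
  (forall m : set A, Smax m -> exists x, m = point_ideal x) -> is_field F.
Proof.
move=> pts c c0; pose a : set A := eval_at F I (fun=> 0) @^-1` [set c * d | d in setT].
have ia : is_ideal a.
  apply: ideal_preimage; split=> // [|_ _ [d _ <-] [e _ <-]|r _ _ [d _ <-]].
  - by exists 0; rewrite ?mulr0.
  - by exists (d + e); rewrite ?mulrDr.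
  - by exists (r * d) => //; rewrite mulrCA.
have [a1|na1] := pselect (a 1).
  by case: a1 => d _; rewrite rmorph1 => cd; exists d.
have [m mm am] := maximal_ideal_exists _ a ia ((proper_idealP _ _ ia).2 na1).
have [x mE] := pts m mm.
have : m c%:A by apply: am; exists 1 => //; rewrite -eval_atE eval_scalar mulr1.
by rewrite mE => /point_idealP; rewrite eval_scalar => /eqP; rewrite (negPf c0).
Qed.

(** For f in the subalgebra, f minus its value at x lies in the ideal generated by
the t - x, by induction on the construction of f. *)
Lemma point_ideal_subalg (J : Type) (i : J -> I) x :
  let S := gen_subalg (range (fun k => tvar F (i k))) in
  point_ideal x `&` S = gen_ideal S (range (fun k => tvar F (i k) - (x (i k))%:A)).
Proof.
move=> S; have SS : subalgebra F A S := subalgebra_gen _ _ _.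
have tS : range (fun k => tvar F (i k)) `<=` S := sub_gen_subalg _ _ _.
have minS := gen_subalg_min _ _ (range (fun k => tvar F (i k))); rewrite -/S in minS.
move: S SS tS minS => S SS tS minS.
pose X := range (fun k => tvar F (i k) - (x (i k))%:A); rewrite -/X.
have [S1 SL SM] := SS.
have St k : S (tvar F (i k)) by apply: tS; exists k.
have Sc c : S c%:A by exact: (subalgebraZ _ _ _ _ _ SS S1).
have XS : X `<=` S.
  by move=> _ [k _ <-]; exact: (subalgebraB _ _ _ _ _ SS (St k) (Sc (x (i k)))).
have [JS J0 JD JM] := ideal_of_gen_ideal _ _ _ _ SS XS.
have XJ : X `<=` gen_ideal S X by exact: sub_gen_smallest.
apply/seteqP; split; last first.
  apply: smallest_sub; last first.
    by move=> _ [k _ <-]; split; [exact: point_ideal_tvar|apply: XS; exists k].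
  have ix := ideal_point _ _ x; split.
  - by move=> f [].
  - by split; [exact: (ideal0 _ _ ix)|exact: (subalgebra0 _ _ _ SS)].
  - move=> f g [xf Sf] [xg Sg].
    by split; [exact: (idealD _ _ _ _ ix xf xg)|rewrite -[f]scale1r; exact: SL].
  - move=> f g Sf [xg Sg].
    by split; [exact: (idealM _ _ _ _ ix xg)|exact: SM].
move=> f [/point_idealP fx Sf].
suff [_] : S f /\ gen_ideal S X (f - (eval f x)%:A) by rewrite fx scale0r subr0.
apply: (minS [set g | S g /\ gen_ideal S X (g - (eval g x)%:A)] _ _ _ Sf).
  split=> [|c g h [Sg Jg] [Sh Jh]|g h [Sg Jg] [Sh Jh]] /=.
  - by split=> //; rewrite eval1 scale1r subrr.
  - split; first exact: SL.
    rewrite evalD eval_scale scalerDl -scalerA opprD addrACA -scalerBr -[c *: _]mulr_algl.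
    by apply: JD => //; exact: (JM _ _ (Sc c) Jg).
  - split; first exact: (SM _ _ Sg Sh).
    have -> : g * h - (eval (g * h) x)%:A =
        g * (h - (eval h x)%:A) + (eval h x)%:A * (g - (eval g x)%:A).
      rewrite evalM !mulrBr addrA [(eval h x)%:A * g]mulrC subrK.
      by rewrite mulr_algl scalerA [eval h x * _]mulrC.
    by apply: JD; [exact: (JM _ _ Sg Jh)|exact: (JM _ _ (Sc _) Jg)].
move=> _ [k _ <-]; split; first exact: St.
by rewrite eval_tvar; apply: XJ; exists k.
Qed.

End PointIdeals.

(** * Homomorphisms from quotients and the equivalence *)

Section Implications.
Variables (F : comNzRingType) (I : choiceType).
Local Notation A := (polyalg F I).
Implicit Types (x : I -> F).

Lemma quotient_evaluation (a : idealr A) x : zero_set [set` a] x ->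
  inhabited {lrmorphism {ideal_quot a} -> F^o}.
Proof.
move=> xa; pose chi (y : {ideal_quot a}) : F^o := eval (repr y) x.
have chiE f : chi (\pi_({ideal_quot a}) f) = eval f x.
  apply/eqP; rewrite -subr_eq0 -evalB; apply/eqP/xa => /=.
  by rewrite Quotient.idealrBE reprK.
have chi_lin : GRing.linear_for *%R chi.
  move=> c y z; rewrite -[y]reprK -[z]reprK; set f := repr y; set g := repr z.
  have -> : c *: \pi_({ideal_quot a}) f = \pi_({ideal_quot a}) (c *: f).
    by rewrite -[c *: f]mulr_algl rmorphM.
  by rewrite -rmorphD !chiE evalD eval_scale.
have chi_mon : monoid_morphism chi.
  split; first by rewrite -(rmorph1 \pi_({ideal_quot a})) chiE eval1.
  move=> y z; rewrite -[y]reprK -[z]reprK; set f := repr y; set g := repr z.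
  by rewrite -rmorphM !chiE evalM.
pose M1 := GRing.isLinear.Build F {ideal_quot a} F^o _ chi chi_lin.
pose M2 := GRing.isMonoidMorphism.Build {ideal_quot a} F^o chi chi_mon.
by constructor; exact: (HB.pack chi M1 M2 : {lrmorphism {ideal_quot a} -> F^o}).
Qed.

Lemma hom_point (a : idealr A) :
  inhabited {lrmorphism {ideal_quot a} -> F^o} -> exists x, [set` a] `<=` point_ideal x.
Proof.
move=> [chi]; pose pi : {rmorphism A -> {ideal_quot a}} := \pi_({ideal_quot a}).
pose x i : F := chi (pi (tvar F i)); exists x => f af; apply/point_idealP.
have scal c : chi (pi c%:A) = c.
  have -> : pi c%:A = c *: 1 by rewrite -[LHS]mulr1.
  by rewrite linearZ /= rmorph1; exact: mulr1.
have -> : eval f x = chi (pi f) by exact: (eval_unique F I (chi \o pi : {rmorphism A -> F}) scal f).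
by have -> : pi f = 0; [exact/quotient_eq0|rewrite rmorph0].
Qed.

(** The residue field at a maximal ideal containing a is generated by the classes of
the variables, so that it is F, and these classes are the coordinates of a
zero. *)
Lemma weak_nullstellensatz_of_extensions : is_field F ->
    (forall K : comAlgType F, is_field K ->
      (exists u : I -> K, gen_subalg (range u) = [set: K]) ->
      range (fun c : F => c%:A : K) = [set: K]) ->
  forall a : set A, is_ideal a -> ~ a 1 -> exists x, zero_set a x.
Proof.
move=> fF ext a ia /(proper_idealP _ _ ia) aT.
have [m mm am] := maximal_ideal_exists _ a ia aT.
have [b mE] := Smax_idealr _ _ mm.
pose pi : {rmorphism A -> {ideal_quot b}} := \pi_({ideal_quot b}).
have piA c : pi c%:A = c%:A by rewrite -[LHS]mulr1.
have fK : is_field {ideal_quot b} by apply: quotient_is_field; rewrite -mE.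
pose u i := pi (tvar F i).
have gen : gen_subalg (range u) = [set: {ideal_quot b}].
  have SS := subalgebra_gen _ _ (range u); have [S1 _ _] := SS.
  apply/seteqP; split=> // y _; rewrite -[y]reprK.
  apply: (polyalg_ind _ _ (pi @^-1` gen_subalg (range u))) => [|c|i].
  - by apply: subring_preimage; exact: subalgebra_subring.
  - by rewrite /preimage /= piA; exact: (subalgebraZ _ _ _ _ _ SS S1).
  - by apply: sub_gen_subalg; exists i.
have triv := ext {ideal_quot b} fK (ex_intro _ u gen).
have /choice[x xP] : forall i, exists c, pi c%:A = pi (tvar F i).
  move=> i; have : [set: {ideal_quot b}] (pi (tvar F i)) by [].
  by rewrite -triv => -[c _ cE]; exists c; rewrite piA.
exists x => f /am mf; apply/(point_idealP _ _ x).
apply: (ideal_sub_point _ _ x m fF (Smax_ideal _ _ mm) (Smax_proper _ _ mm) _ _ mf) => i.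
by rewrite mE; apply/quotient_eq0; rewrite -/pi rmorphB xP subrr.
Qed.

(** Let x be a zero of the kernel of the map that sends t_i to u i. If u i - x i were
nonzero it would have an inverse, the image of some g; then
(t_i - x i) g - 1 would be in the kernel and take the value -1 at x. *)
Lemma trivial_extension_of_weak (K : comAlgType F) (u : I -> K) :
    (forall a : set A, is_ideal a -> ~ a 1 -> exists x, zero_set a x) ->
    is_field K -> gen_subalg (range u) = [set: K] ->
  range (fun c : F => c%:A : K) = [set: K].
Proof.
move=> weak fK gen; pose psi := substitute F K I (in_alg K) u.
have psi_t i : psi (tvar F i) = u i by exact: substitute_tvar.
have psi_c c : psi c%:A = c%:A by exact: substitute_scalar.
have surj y : exists f, psi f = y.
  have : gen_subalg (range u) y by rewrite gen.
  have : subalgebra F K (range psi).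
    split; first by exists 1 => //; rewrite rmorph1.
      move=> c _ _ [f _ <-] [g _ <-]; exists (c *: f + g) => //.
      by rewrite rmorphD /psi substitute_scale /= mulr_algl.
    by move=> _ _ [f _ <-] [g _ <-]; exists (f * g) => //; rewrite rmorphM.
  move=> /(gen_subalg_min _ _ (range u)) min; case/min; last by move=> f _ <-; exists f.
  by move=> _ [i _ <-]; exists (tvar F i).
have ik : is_ideal (psi @^-1` [set 0]).
  apply: ideal_preimage; split=> // [_ _ -> ->|r _ _ ->]; first by rewrite addr0.
  by rewrite mulr0.
have nk1 : ~ (psi @^-1` [set 0]) 1.
  by rewrite /preimage /= rmorph1 => /eqP; rewrite oner_eq0.
have [x xk] := weak _ ik nk1.
have uE i : u i = (x i)%:A.
  apply/eqP; rewrite -subr_eq0; apply/negPn/negP => /fK[z].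
  have [g <-] := surj z; rewrite -psi_t -psi_c -rmorphB -rmorphM => E.
  have /xk : (psi @^-1` [set 0]) ((tvar F i - (x i)%:A) * g - 1).
    by rewrite /preimage /= rmorphB E rmorph1 subrr.
  rewrite evalB eval1 evalM evalB eval_tvar eval_scalar subrr mul0r sub0r.
  by move/eqP; rewrite oppr_eq0 oner_eq0.
apply/seteqP; split=> // y _; have : gen_subalg (range u) y by rewrite gen.
apply: gen_subalg_min; first exact: subalgebra_scalars.
by move=> _ [i _ <-]; exists (x i).
Qed.

(** For nonzero c, the multiples of c have no common zero, so that some power of 1 is a
multiple of c. *)
Lemma field_of_strong_nullstellensatz :
    (forall a : set A, is_ideal a -> radical a = vanishing_ideal (zero_set a)) ->
  is_field F.
Proof.
move=> strong c c0; pose a : set A := range (fun g : A => c *: g).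
have ia : is_ideal a.
  split=> // [|_ _ [g _ <-] [h _ <-]|r _ _ [g _ <-]].
  - by exists 0; rewrite ?scaler0.
  - by exists (g + h); rewrite ?scalerDr.
  - by exists (r * g) => //; rewrite scalerAr.
have : radical a 1.
  rewrite strong // => x /(_ (c *: 1)) /(_ (imageP _ Logic.I)).
  by rewrite eval_scalar => /eqP; rewrite (negPf c0).
move=> [n]; rewrite expr1n => -[g _] /(congr1 (fun f => eval f (fun=> 0))).
by rewrite eval_scale eval1 => cg; exists (eval g (fun=> 0)).
Qed.

Lemma weak_of_strong_nullstellensatz :
    (forall a : set A, is_ideal a -> radical a = vanishing_ideal (zero_set a)) ->
  forall a : set A, is_ideal a -> ~ a 1 -> exists x, zero_set a x.
Proof.
move=> strong a ia na1; apply: contrapT => /forallNP nx; apply: na1.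
have [n] : radical a 1 by rewrite strong // => x /nx.
by rewrite expr1n.
Qed.

End Implications.

Lemma rational_zero (F : comNzRingType) (I : choiceType) (a : set (polyalg F I)) :
    is_field F -> GRing.closed_field_axiom F -> card_lt [set: I] [set: F] ->
    is_ideal a -> ~ a 1 ->
  exists x, zero_set a x.
Proof.
move=> /fieldE[F' FE]; case: _ / FE in a * => closedF [_ FI].
exact: zero_set_nonempty.
Qed.

Theorem theorem1p1 (F : comNzRingType) (I : choiceType) (hI : inhabited I) :
  [<->
    (* (a) *)
    [/\ is_field F, GRing.closed_field_axiom F
      & card_lt [set: I] [set: F]];
    (* (b) *)
    forall a : idealr (polyalg F I),
      inhabited {lrmorphism {ideal_quot a} -> F^o};
    (* (c) *)
    forall m : idealr (polyalg F I), Smax [set` m] ->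
      inhabited {lrmorphism {ideal_quot m} -> F^o};
    (* (d) *)
    forall m : set (polyalg F I), Smax m ->
      exists x : I -> F, m = point_ideal x;
    (* (e) *)
    set_bij [set: I -> F] (@Smax (polyalg F I)) (@point_ideal F I);
    (* (f) *)
    is_field F /\
    (forall m : set (polyalg F I), Smax m ->
      forall (n : nat) (i : 'I_n -> I), (0 < n)%N ->
      exists x : I -> F,
        m `&` gen_subalg (range (fun k => tvar F (i k))) =
        gen_ideal (gen_subalg (range (fun k => tvar F (i k))))
                  (range (fun k => tvar F (i k) - (x (i k))%:A)));
    (* (g) *)
    is_field F /\
    (forall a : set (polyalg F I), is_ideal a ->
      (zero_set a = set0 <-> a = [set: polyalg F I]));
    (* (h) *)
    is_field F /\
    (forall K : comAlgType F, is_field K ->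
      (exists u : I -> K, gen_subalg (range u) = [set: K]) ->
      range (fun c : F => c%:A : K) = [set: K]);
    (* (i) *)
    forall a : set (polyalg F I), is_ideal a ->
      radical a = vanishing_ideal (zero_set a)
  ].
Proof.
tfae.
- move=> [fF closedF IF] a.
  have [ia aT] := (idealrP [set` a]).2 (ex_intro _ a erefl).
  have [x xa] := rational_zero _ _ _ fF closedF IF ia ((proper_idealP _ _ ia).1 aT).
  exact: quotient_evaluation xa.
- by move=> pts m _.
- move=> pts m /[dup] mm /Smax_idealr[b mE].
  have [|x xb] := hom_point _ _ b _; first by apply: pts; rewrite -mE.
  by exists x; apply: Smax_point => //; rewrite mE.
- move=> pts; have fF := field_of_maximal_points _ _ pts; split.
  + by move=> x _; exact: point_ideal_Smax.
  + by move=> x y _ _; exact: point_ideal_inj.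
  + by move=> m /pts[x ->]; exists x.
- move=> [mx _ surj]; split; first exact: (field_of_Smax _ _ (fun=> 0)) (mx _ Logic.I).
  by move=> m /surj[x _ <-] n i _; exists x; exact: point_ideal_subalg.
- move=> [fF loc]; split=> // a ia; split; last by move=> ->; exact: zero_set_full.
  move=> a0; apply: contrapT => aT; have [m mm am] := maximal_ideal_exists _ a ia aT.
  have /choice[x xP] : forall i, exists c : F, m (tvar F i - c%:A).
    move=> i; have [x xE] := loc m mm 1%N (fun=> i) erefl; exists (x i).
    have : (m `&` gen_subalg (range (fun _ : 'I_1 => tvar F i))) (tvar F i - (x i)%:A).
      by rewrite xE; apply: sub_gen_smallest; exists ord0.
    by case.
  have : zero_set a x.
    move=> f /am mf; apply/(point_idealP _ _ x).
    exact: (ideal_sub_point _ _ x m fF (Smax_ideal _ _ mm) (Smax_proper _ _ mm) xP).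
  by rewrite a0.
- move=> [fF weak]; split=> // K fK [u gen].
  apply: trivial_extension_of_weak fK gen => a ia na1.
  apply: contrapT => /forallNP nx; apply: na1.
  by rewrite ((weak a ia).1 _) //; apply/seteqP; split=> // x /nx.
- move=> [fF ext]; have weak := weak_nullstellensatz_of_extensions _ _ fF ext.
  move=> {ext}; have [F' FE] := fieldE _ fF; case: _ / FE in weak * => a ia.
  have [closedF [_ FI]] := weak_nullstellensatz_converse _ _ weak hI.
  exact: strong_nullstellensatz.
- move=> strong; have fF := field_of_strong_nullstellensatz _ _ strong.
  have weak := weak_of_strong_nullstellensatz _ _ strong.
  move=> {strong}; split=> //; move: weak;
    have [F' FE] := fieldE _ fF; case: _ / FE => weak;
    by have [] := weak_nullstellensatz_converse _ _ weak hI.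
Qed.
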